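(* Let $\Omega\subset\mathbb{R}^n$ be an open connected set and let $\rho$ be a symmetric quasi-metric on $\Omega$ whose balls are Lebesgue measurable and which is compatible with the Euclidean distance in the sense given in the context. Fix $1<p<\infty$ and $1<t\le\infty$, and let $Q$ be a measurable function on $\Omega$ with values in the symmetric positive semi-definite $n\times n$ matrices such that $Q\in L^{\frac{pt}{2}}_{\mathrm{loc}}(\Omega)$. Suppose that, for some $\sigma\ge1$ and some $s>p\sigma'$ (with a common function $r_1$), the cutoff condition of order $s$, the local Poincaré property of order $p$ with gain $t'=\frac{s}{s-p}$, and the local Sobolev property of order $p$ with gain $\sigma$ hold in $\Omega$. Then for every open set $\Theta\Subset\Omega$ there is a positive constant $C(\Theta)$ such that $$\Big(\int_\Theta|f|^{p\sigma}\,dx\Big)^{\frac{1}{p\sigma}}\le C(\Theta)\Big(\int_\Theta|\sqrt{Q}\nabla f|^p\,dx\Big)^{\frac1p}$$ holds for all $f\in Lip_0(\Theta)$.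
   Context: Notation: primes on exponents denote Hölder conjugates ($\frac1\sigma+\frac1{\sigma'}=1$, $\sigma'=\infty$ if $\sigma=1$; $\frac1t+\frac1{t'}=1$), so $t'=\frac{s}{s-p}$ means $s=pt$, with $t'=1$ when $s=t=\infty$. $\frac{1}{|B|}\int_B$ is the average, written $\fint_B$; $f_B=\fint_B f\,dx$. $|Q(x)|_{\mathrm{op}}=\sup_{|\xi|=1}|Q(x)\xi|$, and $Q\in L^r_{\mathrm{loc}}$ means $|Q|_{\mathrm{op}}\in L^r_{\mathrm{loc}}$; $\sqrt{Q}$ is the positive semi-definite square root. For an open set $U$, $\Theta\Subset U$ means $\Theta$ bounded and $\overline\Theta\subset U$; $Lip_0(U)$ is the set of Lipschitz functions $f$ with $\operatorname{supp}(f)\Subset U$; $Lip(U)$ is the set of Lipschitz functions on $U$. Quasi-metric: $\rho:\Omega\times\Omega\to\mathbb{R}$ and there is $\kappa\ge1$ such that for all $x,y,z\in\Omega$: $\rho(x,y)=0$ iff $x=y$; $\rho(x,y)=\rho(y,x)$; $\rho(x,y)\le\kappa(\rho(x,z)+\rho(z,y))$. $B(x,r)=\{y\in\Omega:\rho(x,y)<r\}$ is the $\rho$-ball and $D(x,r)=\{y\in\Omega:|x-y|<r\}$ the Euclidean ball. Compatibility with the Euclidean distance: for $x,y\in\Omega$, $|x-y|\to0$ iff $\rho(x,y)\to0$; equivalently, for every $x\in\Omega$ and $\epsilon>0$ there is $\delta>0$ with $D(x,\delta)\subset B(x,\epsilon)$, and for every $\delta>0$ there is $\gamma>0$ with $B(x,\gamma)\subset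 D(x,\delta)$. Fix a positive continuous function $r_1:\Omega\to(0,\infty)$, common to the following three conditions. Local Sobolev property of order $p$ with gain $\sigma$: there is $C_0>0$ such that for all $y\in\Omega$, $0<r<r_1(y)$, $f\in Lip_0(B(y,r))$, $$\Big(\fint_{B(y,r)}|f|^{p\sigma}dx\Big)^{\frac1{p\sigma}}\le C_0r\Big(\fint_{B(y,r)}|\sqrt Q\nabla f|^pdx\Big)^{\frac1p}+C_0\Big(\fint_{B(y,r)}|f|^pdx\Big)^{\frac1p}.$$ Local Poincaré property of order $p$ with gain $t'\ge1$: there are $C_1>0$, $\beta\ge1$ such that for all $y\in\Omega$ and $r$ with $0<\beta r<r_1(y)$, $$\Big(\fint_{B(y,r)}|f-f_{B(y,r)}|^{pt'}dx\Big)^{\frac1{pt'}}\le C_1r\Big(\fint_{B(y,\beta r)}|\sqrt Q\nabla f|^pdx\Big)^{\frac1p}$$ for every $f\in Lip(B(y,\beta r))$ with $\sqrt Q\nabla f\in L^p(B(y,\beta r))$. Cutoff condition of order $1\le s\le\infty$: there are constants $C_3,N>0$ and $0<\alpha<1$ such that for every $x\in\Omega$ and $0<r<r_1(x)$ there is a sequence $\{\psi_j\}_{j=1}^\infty\subset Lip_0(B(x,r))$ such that for all $j$: $0\le\psi_j\le1$; $\operatorname{supp}\psi_1\subset B(x,r)$; $B(x,\alpha r)\subset\{y\in B(x,r):\psi_j(y)=1\}$; $\operatorname{supp}\psi_{j+1}\subset\{y\in B(x,r):\psi_j(y)=1\}$; and $\big(\fint_{B(x,r)}|\sqrt{Q(y)}\nabla\psi_j(y)|^s\,dy\big)^{1/s}\le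 C_3\frac{N^j}{r}$ (essential supremum if $s=\infty$). *)

(* Defs.v *)
From HB Require Import structures.
From mathcomp Require Import all_boot all_order all_algebra.
From mathcomp Require Import all_classical all_reals all_analysis.

Set Implicit Arguments.
Unset Strict Implicit.
Unset Printing Implicit Defensive.

Import Order.TTheory GRing.Theory Num.Theory.
Import numFieldNormedType.Exports.

Local Open Scope classical_set_scope.
Local Open Scope ring_scope.

(* R^N is 'rV[R]_n.+1 with N = n.+1, so that N >= 1.  The norm `| x | of
   'rV[R]_n.+1 is the sup norm; it is used only through the notions that all
   norms share (topology, boundedness, being Lipschitz). *)

(* Euclidean norm of a row or of a column vector. *)
Definition enorm (R : realType) (m n : nat) (v : 'M[R]_(m, n)) : R :=
  Num.sqrt (\sum_i \sum_j v i j ^+ 2).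

Section LebesgueMeasure.
Context {R : realType} {n : nat}.
Local Notation E := 'rV[R]_n.+1.
Local Open Scope ereal_scope.

Definition box (c : E * E) : set E :=
  [set x | forall i, (c.1 ord0 i < x ord0 i <= c.2 ord0 i)%R].

Definition box_vol (c : E * E) : R :=
  (\prod_i Num.max 0 (c.2 ord0 i - c.1 ord0 i))%R.

Definition box_cover (X : set E) : set (nat -> E * E) :=
  [set c | X `<=` \bigcup_k box (c k)].

Definition lebesgue_outer (X : set E) : \bar R :=
  ereal_inf [set \sum_(k <oo) (box_vol (c k))%:E | c in box_cover X].

Lemma box_vol_ge0 c : (0 <= box_vol c)%R.
Proof. by apply: prodr_ge0 => i _; rewrite le_max lexx. Qed.

Lemma lebesgue_outer_ge0 X : 0 <= lebesgue_outer X.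
Proof.
apply: le_ereal_inf_tmp => _ [c _ <-].
by apply: nneseries_ge0 => k _ _; rewrite lee_fin box_vol_ge0.
Qed.

Lemma lebesgue_outer0 : lebesgue_outer set0 = 0.
Proof.
apply/eqP; rewrite eq_le lebesgue_outer_ge0 andbT.
apply: ereal_inf_lbound; exists (fun=> (0, 0)%R) => //.
apply: eseries0 => k _ _; congr EFin.
by rewrite /box_vol (bigD1 ord0)//= subrr maxxx mul0r.
Qed.

Lemma le_lebesgue_outer :
  {homo lebesgue_outer : A B / A `<=` B >-> A <= B}.
Proof.
move=> A B AB; apply/ereal_inf_le_tmp => _ [c Bc <-].
by exists c => //; exact: subset_trans AB Bc.
Qed.

Lemma lebesgue_outer_sigma_subadditive : sigma_subadditive lebesgue_outer.
Proof.
move=> A; have [[i ioo]|] := pselect (exists i, lebesgue_outer (A i) = +oo).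
  rewrite (eseries_pinfty _ _ ioo) ?leey// => k _.
  by rewrite -ltNye (lt_le_trans _ (lebesgue_outer_ge0 _)).
rewrite -forallNE => Aoo.
suff add2e (e : {posnum R}) : lebesgue_outer (\bigcup_k A k) <=
    \sum_(i <oo) lebesgue_outer (A i) + e%:num%:E.
  by apply/lee_addgt0Pr => _/posnumP[].
rewrite (le_trans _ (epsilon_trick _ _ _))//; last first.
  by move=> k; exact: lebesgue_outer_ge0.
pose P k (c : nat -> E * E) := box_cover (A k) c /\
  \sum_(j <oo) (box_vol (c j))%:E <=
  lebesgue_outer (A k) + (e%:num / (2 ^ k.+1)%:R)%:E.
have [G PG] : {G : nat -> nat -> E * E & forall k, P k (G k)}.
  apply: (@choice _ _ P) => k; rewrite /P.
  have Afin : lebesgue_outer (A k) \is a fin_num.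
    by rewrite ge0_fin_numE ?lebesgue_outer_ge0// ltey; apply/eqP/Aoo.
  have e0 : (0 < e%:num / (2 ^ k.+1)%:R)%R by [].
  have [_ [c Ac <-] ltc] := lb_ereal_inf_adherent e0 Afin.
  by exists c; split => //; exact: ltW.
pose vol c := (box_vol c)%:E : \bar R.
have vol_ge0 x : 0 <= (vol \o uncurry G) x by rewrite lee_fin box_vol_ge0.
apply: (@le_trans _ _ (\esum_(i in setT) (vol \o uncurry G) i)).
  apply: ereal_inf_lbound => /=.
  have /card_esym/ppcard_eqP[f] := card_nat2.
  exists (uncurry G \o f).
    move=> t [i _ /(PG i).1 [j _ Gijt]].
    by exists (f^-1%FUN (i, j)) => //=; rewrite invK ?inE.
  rewrite -(esum_pred_image (vol \o uncurry G) _ xpredT) ?[fun=> _]set_true//.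
  by rewrite image_eq.
rewrite (_ : esum _ _ = \sum_(i <oo) \sum_(j <oo) vol (G i j)); last first.
  pose J : nat -> set (nat * nat) := fun i => [set (i, j) | j in setT].
  rewrite (_ : setT = \bigcup_k J k); last first.
    by rewrite predeqE => -[a b]; split => // _; exists a => //; exists b.
  rewrite esum_bigcupT /=; last 2 first.
    - apply/trivIsetP => i j _ _ ij.
      rewrite predeqE => -[k m] /=; split => //= -[] [_] _ [<-{k} _].
      by move=> [m' _] [] /esym/eqP; rewrite (negbTE ij).
    - by move=> x; exact: (vol_ge0 x).
  rewrite -(image_id [set: nat]) -fun_true esum_pred_image//; last first.
    by move=> k _; apply: esum_ge0 => x _; exact: (vol_ge0 x).
  apply: eq_eseriesr => /= j _.
  rewrite -(esum_pred_image (vol \o uncurry G) (pair j) predT)/=; last 2 first.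
    - by move=> k _; exact: (vol_ge0 (j, k)).
    - by move=> ? ? _ _ [].
  by congr esum; rewrite predeqE => -[a b]; split; move=> [i _ <-]; exists i.
apply: lee_nneseries => [k *|k _]; last exact: (PG k).2.
by apply: nneseries_ge0 => j *; exact: (vol_ge0 (k, j)).
Qed.

HB.instance Definition _ := isOuterMeasure.Build R E lebesgue_outer
  lebesgue_outer0 lebesgue_outer_ge0 le_lebesgue_outer
  lebesgue_outer_sigma_subadditive.

(* The measurable sets of [caratheodory_type lebesgue_outer] are all the
   Lebesgue measurable sets, not only the Borel ones. *)
Definition lebesgue_rV : set (caratheodory_type lebesgue_outer) -> \bar R :=
  lebesgue_outer.

HB.instance Definition _ := isMeasure.Build _ _ _ lebesgue_rV
  (@caratheodory_measure0 _ _ lebesgue_outer)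
  (@caratheodory_measure_ge0 _ _ lebesgue_outer)
  (@caratheodory_measure_sigma_additive _ _ lebesgue_outer).

End LebesgueMeasure.

Notation lebesgue_measurable A :=
  (lebesgue_outer.-cara.-measurable A) (only parsing).

Section LebesgueNorms.
Context {R : realType} {n : nat}.
Local Notation E := 'rV[R]_n.+1.
Local Notation mu := (@lebesgue_rV R n).
Local Open Scope ereal_scope.

(* norm of L^q(A), 0 < q <= +oo *)
Definition norm_on (A : set E) (q : \bar R) (g : E -> R) : \bar R :=
  'N[mu]_q [(EFin \o g) \_ A].

Definition in_L (A : set E) (q : \bar R) (g : E -> R) : Prop :=
  measurable_fun (A : set (caratheodory_type lebesgue_outer)) g /\
  norm_on A q g < +oo.

Definition in_Lloc (U : set E) (q : \bar R) (g : E -> R) : Prop :=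
  forall K, compact K -> K `<=` U -> in_L K q g.

Definition avg (A : set E) (g : E -> \bar R) : \bar R :=
  (mu A)^-1 * \int[mu]_(x in A) g x.

(* the essential supremum if q = +oo *)
Definition avg_norm (A : set E) (q : \bar R) (g : E -> R) : \bar R :=
  if q is r%:E then avg A (fun x => (`|g x| `^ r)%:E) `^ r^-1
  else norm_on A q g.

End LebesgueNorms.

Section Matrices.
Context {R : realType} {N : nat}.

Definition psd (A : 'M[R]_N) : Prop :=
  A^T = A /\ forall v : 'cV[R]_N, 0 <= (v^T *m A *m v) ord0 ord0.

(* the positive semi-definite square root of a positive semi-definite A *)
Definition psd_sqrt (A : 'M[R]_N) : 'M[R]_N :=
  xget 0 [set S | psd S /\ S *m S = A].

Definition op_norm (A : 'M[R]_N) : R :=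
  sup [set enorm (A *m xi) | xi in [set xi : 'cV[R]_N | enorm xi = 1]].

End Matrices.

Section LipschitzFunctions.
Context {R : realType} {n : nat}.
Local Notation E := 'rV[R]_n.+1.

(* A Lipschitz function has partial derivatives almost everywhere; ['D_v f x]
   has a meaningless value at the other points. *)
Definition grad (f : E -> R) (x : E) : 'cV[R]_n.+1 :=
  \col_i 'D_(delta_mx ord0 i) f x.

Definition wgrad (Q : E -> 'M[R]_n.+1) (f : E -> R) (x : E) : R :=
  enorm (psd_sqrt (Q x) *m grad f x).

Definition supp (f : E -> R) : set E := closure [set x | f x != 0].

Definition well_inside (A U : set E) : Prop :=
  bounded_set A /\ closure A `<=` U.

Definition Lip0 (U : set E) (f : E -> R) : Prop :=
  lipschitz f /\ well_inside (supp f) U.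

End LipschitzFunctions.

Section QuasiMetric.
Context {R : realType} {n : nat}.
Local Notation E := 'rV[R]_n.+1.
Variables (Omega : set E) (rho : E -> E -> R).

Definition quasi_metric : Prop :=
  exists kappa : R, 1 <= kappa /\
  forall x y z, Omega x -> Omega y -> Omega z ->
    [/\ rho x y = 0 <-> x = y,
        rho x y = rho y x &
        rho x y <= kappa * (rho x z + rho z y)].

Definition qball (x : E) (r : R) : set E :=
  [set y | Omega y /\ rho x y < r].

Definition eball (x : E) (r : R) : set E :=
  [set y | Omega y /\ enorm (x - y) < r].

Definition euclidean_compatible : Prop :=
  forall x, Omega x ->
    (forall eps, 0 < eps ->
       exists2 delta, 0 < delta & eball x delta `<=` qball x eps) /\
    (forall delta, 0 < delta ->
       exists2 gamma, 0 < gamma & qball x gamma `<=` eball x delta).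

Variables (Q : E -> 'M[R]_n.+1) (r1 : E -> R) (p : R).

Definition local_sobolev (sigma : R) : Prop :=
  exists2 C0 : R, 0 < C0 &
  forall (y : E) (r : R) (f : E -> R),
    Omega y -> 0 < r < r1 y -> Lip0 (qball y r) f ->
    (avg_norm (qball y r) (p * sigma)%:E f <=
       (C0 * r)%:E * avg_norm (qball y r) p%:E (wgrad Q f) +
       C0%:E * avg_norm (qball y r) p%:E f)%E.

(* An element of Lip(B(y, beta r)) is represented by a Lipschitz function f on
   R^N that extends it.  There is always one (McShane), and two of them have
   the same gradient almost everywhere in the ball.  The ball need not be open,
   so the values on it alone do not give ['D_v f] at all of its points. *)
Definition local_poincare (gain : \bar R) : Prop :=
  exists C1 beta : R, [/\ 0 < C1, 1 <= beta &
  forall (y : E) (r : R) (f : E -> R),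
    Omega y -> 0 < beta * r < r1 y ->
    lipschitz f -> in_L (qball y (beta * r)) p%:E (wgrad Q f) ->
    let fB := fine (avg (qball y r) (EFin \o f)) in
    (avg_norm (qball y r) (p%:E * gain) (fun x => f x - fB)%R <=
       (C1 * r)%:E * avg_norm (qball y (beta * r)) p%:E (wgrad Q f))%E].

Definition cutoff_condition (s : \bar R) : Prop :=
  exists C3 N alpha : R, [/\ 0 < C3, 0 < N, 0 < alpha < 1 &
  forall (x : E) (r : R), Omega x -> 0 < r < r1 x ->
  exists psi : nat -> E -> R, supp (psi 1%N) `<=` qball x r /\
  forall j : nat, (1 <= j)%N ->
    [/\ Lip0 (qball x r) (psi j),
        forall y, 0 <= psi j y <= 1,
        qball x (alpha * r) `<=` [set y | qball x r y /\ psi j y = 1],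
        supp (psi j.+1) `<=` [set y | qball x r y /\ psi j y = 1] &
        (avg_norm (qball x r) s (wgrad Q (psi j)) <=
           (C3 * (N ^+ j / r))%:E)%E]].

End QuasiMetric.

(* Main.v *)
(* On a rho-ball B with a small radius, the Poincare inequality bounds the
   L^(pt') norm of f - c by the norm G of the gradient, for some constant c.
   If B meets an open set on which the L^(pt') norm of f is already at most a
   multiple of G, then so is |c|, and hence the L^(pt') norm of f on B.  Since
   f = 0 on the nonempty open set Omega \ closure Theta and Omega is connected,
   every point of Omega has a neighbourhood on which f is bounded by G in
   L^(pt').  For a cutoff function psi, the Sobolev inequality for psi f,
   the product rule and Hoelder's inequality 1/p = 1/(pt') + 1/s turn this into
   a local L^(p sigma) bound by G alone, and finitely many such neighbourhoods
   cover closure Theta.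

   The product rule holds only where the partial derivatives exist.  A Lipschitz
   function on a line is differentiable almost everywhere, by the Radon-Nikodym
   theorem and Lebesgue differentiation, and Tonelli's theorem transfers this to
   the partial derivatives on R^N. *)

Require Import Defs.
From HB Require Import structures.
From mathcomp Require Import all_boot all_order all_algebra.
From mathcomp Require Import all_classical all_reals all_analysis.
From mathcomp Require Import measurable_realfun ess_sup_inf ring lra.

Set Implicit Arguments.
Unset Strict Implicit.
Unset Printing Implicit Defensive.

Import Order.TTheory GRing.Theory Num.Theory.
Import numFieldNormedType.Exports.

Local Open Scope classical_set_scope.
Local Open Scope ring_scope.

(** Two obstacles shape the preparatory parts. First, [psd_sqrt] picks some S with S S = A, so its
    dependence on A is not visible. Once a root is known to exist, |sqrt(Q) v| is replaced
    everywhere by the square root of the quadratic form v^T Q v; this expression gives measurability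
    of [wgrad] and the triangle inequality behind the product rule. Second, Lebesgue measure on R^N
    is given as a bare outer measure without product structure. Tonelli applies only after it is
    identified, on the sigma-algebra generated by the boxes, with an iterated product measure; hence
    an exceptional set is shown to lie in that sigma-algebra before its slices are examined.

    In the main argument, what spreads through Omega is the existence of a constant uniform in f,
    with no uniformity in the point. All gradient norms are taken over the whole of Theta, which is
    possible because [wgrad Q f] vanishes off the support of f; this makes bounds obtained on
    different sets comparable. The starting set Omega \ closure Theta is nonempty because a nonempty
    open subset of R^N is never compact. *)

Lemma ler_coord_norm {R : realType} n (x : 'rV[R]_n) i : `|x ord0 i| <= `|x|.
Proof.
rewrite [leRHS]mx_normrE.
exact: (le_bigmax _ (fun ij => `|x ij.1 ij.2|) (ord0, i)).
Qed.

Lemma mx_norm_le {R : realType} n (x : 'rV[R]_n) (e : R) : 0 <= e ->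
  (forall i, `|x ord0 i| <= e) -> `|x| <= e.
Proof.
move=> e0 xe; rewrite [leLHS]mx_normrE; apply/bigmax_leP; split => // -[k i] _.
by rewrite ord1.
Qed.

(** * Positive semi-definite forms *)

Section psd_square_root.
Context {R : realType} {N : nat}.
Implicit Types (A B S : 'M[R]_N.+1) (u v w : 'cV[R]_N.+1).

Definition qform A u v : R := (u^T *m A *m v) ord0 ord0.

Lemma qformC A u v : A^T = A -> qform A u v = qform A v u.
Proof.
by move=> As; rewrite /qform -[in LHS](trmxK (u^T *m A *m v)) mxE !trmx_mul trmxK As mulmxA.
Qed.

Lemma qformDl A u u' v : qform A (u + u') v = qform A u v + qform A u' v.
Proof. by rewrite /qform linearD/= !mulmxDl mxE. Qed.

Lemma qformDr A u v v' : qform A u (v + v') = qform A u v + qform A u v'.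
Proof. by rewrite /qform mulmxDr mxE. Qed.

Lemma qformZl A a u v : qform A (a *: u) v = a * qform A u v.
Proof. by rewrite /qform linearZ/= -!scalemxAl mxE. Qed.

Lemma qformZr A a u v : qform A u (a *: v) = a * qform A u v.
Proof. by rewrite /qform -scalemxAr mxE. Qed.

Lemma qform1 v : qform 1%:M v v = \sum_i v i ord0 ^+ 2.
Proof. by rewrite /qform mulmx1 mxE; apply: eq_bigr => i _; rewrite mxE expr2. Qed.

Lemma qform1_ge0 v : 0 <= qform 1%:M v v.
Proof. by rewrite qform1 sumr_ge0// => i _; exact: sqr_ge0. Qed.

Lemma qform1_eq0 v : qform 1%:M v v = 0 -> v = 0.
Proof.
rewrite qform1 => /eqP; rewrite psumr_eq0 => [/allP v0|i _]; last exact: sqr_ge0.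
apply/matrixP => i j; rewrite ord1 mxE; apply/eqP.
by have := v0 i (mem_index_enum _); rewrite sqrf_eq0.
Qed.

Lemma psd_null A v : psd A -> qform A v v = 0 -> A *m v = 0.
Proof.
move=> [As A0] v0; apply: qform1_eq0; set w := A *m v; set b := qform _ _ _.
have bE : qform A w v = b by rewrite /b /qform mulmx1 -mulmxA.
have b0 : 0 <= b by exact: qform1_ge0.
set c := qform A w w; have c0 : 0 <= c by exact: A0.
(* Move from v by the step -b/(c+1) along w = A v. The exact minimiser would be -b/c; c + 1 avoids
   the case c = 0 and still gives the form the value -b^2 (c+2)/(c+1)^2, negative unless b = 0. *)
have c1 : c + 1 != 0 by rewrite gt_eqF// ltr_wpDl.
have := A0 (v + (- b / (c + 1)) *: w); rewrite -/(qform _ _ _).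
rewrite qformDl !qformDr !qformZl !qformZr v0 (qformC v w)// bE -/c.
have -> : 0 + - b / (c + 1) * b + (- b / (c + 1) * b +
  - b / (c + 1) * (- b / (c + 1) * c)) = - (b ^+ 2 * (c + 2) / (c + 1) ^+ 2) by field.
rewrite oppr_ge0 => H; apply/eqP; move: H; apply: contraTT => bn0.
by rewrite -ltNge divr_gt0 ?mulr_gt0 ?exprn_gt0 ?lt0r ?bn0 ?sqrf_eq0 ?sqr_ge0 ?b0//;
  lra.
Qed.

Lemma qform_continuous A : continuous (fun x : 'rV[R]_N.+1 => qform A x^T x^T).
Proof.
have -> : (fun x : 'rV[R]_N.+1 => qform A x^T x^T) =
  (fun x => \sum_i \sum_j x ord0 i * A i j * x ord0 j).
  apply/funext => x; rewrite /qform trmxK mxE exchange_big/=.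
  by apply: eq_bigr => j _; rewrite !mxE big_distrl/=.
apply: (@continuous_big _ _ +%R 0 _ (@add_continuous R^o)) => i _.
apply: (@continuous_big _ _ +%R 0 _ (@add_continuous R^o)) => j _.
have ci k : continuous (fun y : 'rV[R]_N.+1 => y ord0 k : R^o).
  exact: coord_continuous.
move=> x; exact: (cvgM (cvgM (ci i x) (cvg_cst _)) (ci j x)).
Qed.

(** Take a maximiser v of the form on the unit sphere, with maximum a. Then a I - A is positive
    semi-definite and its form vanishes at v, so [psd_null] makes v an eigenvector. If a were 0, the
    form would vanish on the basis vectors, and [psd_null] would give A = 0. *)
Lemma psd_top_eigenvector A : psd A -> A != 0 ->
  exists v a, [/\ 0 < a, qform 1%:M v v = 1 & A *m v = a *: v].
Proof.
move=> /[dup] Apsd [As A0] An0.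
pose S := [set x : 'rV[R]_N.+1 | qform 1%:M x^T x^T = 1].
have S0 : S !=set0.
  exists (delta_mx ord0 ord0); rewrite /S /= qform1 (bigD1 ord0)//= !mxE !eqxx.
  rewrite expr1n big1 ?addr0// => i i0; rewrite !mxE eqxx/=.
  by rewrite (negbTE i0) expr0n.
have cS : compact S.
  apply: bounded_closed_compact.
    exists 1; split => // M M1 x xS; apply/ltW; apply: le_lt_trans M1.
    apply: mx_norm_le => // j; rewrite -[leLHS]sqrtr_sqr -[leRHS]sqrtr1.
    rewrite ler_wsqrtr// -xS qform1 (bigD1 j)//= mxE lerDl.
    by rewrite sumr_ge0// => i _; exact: sqr_ge0.
  have -> : S = (fun x => qform 1%:M x^T x^T) @^-1` [set 1 : R] by [].
  apply: preimage_closed; last exact: closed_eq.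
  by move=> x _; exact: qform_continuous.
have [v /set_mem Sv vmax] := compact_EVT_max S0 cS
  (continuous_subspaceT (@qform_continuous A)).
pose a := qform A v^T v^T.
have qa w : qform A w w <= a * qform 1%:M w w.
  have [->|w0] := eqVneq w 0; first by rewrite /qform !mulmx0 mxE mulr0.
  pose b := qform 1%:M w w.
  have b0 : 0 < b.
    by rewrite lt0r qform1_ge0 andbT; apply: contra_neq w0 => /qform1_eq0.
  pose u := (Num.sqrt b)^-1 *: w.
  have bb : (Num.sqrt b)^-1 * ((Num.sqrt b)^-1 * b) = 1.
    by rewrite mulrA -invfM -expr2 sqr_sqrtr ?ltW// mulVf// gt_eqF.
  have : S u^T by rewrite /S /= trmxK qformZl qformZr.
  move=> /mem_set/vmax; rewrite trmxK qformZl qformZr -/a => ua.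
  rewrite -/b; have -> : qform A w w =
      (Num.sqrt b)^-1 * ((Num.sqrt b)^-1 * qform A w w) * b.
    by rewrite -[LHS]mul1r -[in LHS]bb; ring.
  exact: ler_wpM2r (ltW b0) _ _ ua.
have a0 : 0 <= a by exact: A0.
have Bpsd : psd (a%:M - A).
  split=> [|w]; first by rewrite linearB/= tr_scalar_mx As.
  rewrite mulmxBr mulmxBl mxE [X in _ + X]mxE subr_ge0 -scalemx1.
  by rewrite -scalemxAr -scalemxAl [leRHS]mxE; exact: qa.
have Av : A *m v^T = a *: v^T.
  apply/esym/eqP; rewrite -subr_eq0 -mul_scalar_mx -mulmxBl; apply/eqP.
  apply: psd_null => //; rewrite /qform mulmxBr mulmxBl mxE [X in _ + X]mxE.
  rewrite -scalemx1 -scalemxAr -scalemxAl [X in X - _]mxE -/(qform 1%:M _ _).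
  by rewrite Sv mulr1 subrr.
exists v^T, a; split => //; rewrite lt0r a0 andbT.
apply: contra_neq An0 => a_eq0; apply/matrixP => i j; rewrite [RHS]mxE.
have /matrixP/(_ i ord0) : A *m (delta_mx j ord0 : 'cV_N.+1) = 0.
  apply: psd_null => //; apply/eqP; rewrite eq_le A0 andbT.
  by have := qa (delta_mx j ord0); rewrite a_eq0 mul0r.
by rewrite -colE !mxE.
Qed.

(* Deflation: subtracting the top eigenvalue times the projection on a unit
   eigenvector keeps A positive semi-definite and lowers its rank. *)
Lemma psd_sqrt_ex A : psd A -> exists S, psd S /\ S *m S = A.
Proof.
have [k] := ubnP (\rank A); elim: k A => // k IH A Ak /[dup] Apsd [As A0].
have [->|An0] := eqVneq A 0.
  exists 0; rewrite mulmx0; split => //; split => [|v]; first by rewrite trmx0.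
  by rewrite mulmx0 mul0mx mxE.
have [v [a [a0 v1 Av]]] := psd_top_eigenvector Apsd An0.
have vv : v^T *m v = 1%:M.
  by rewrite [LHS]mx11_scalar -v1 /qform mulmx1.
have vA : v^T *m A = a *: v^T by rewrite -[LHS]trmxK trmx_mul trmxK As Av linearZ.
pose P := v *m v^T.
have PT : P^T = P by rewrite /P trmx_mul trmxK.
have PP : P *m P = P by rewrite /P mulmxA -(mulmxA v) vv mulmx1.
have AP : A *m P = a *: P by rewrite /P mulmxA Av scalemxAl.
have PA : P *m A = a *: P by rewrite /P -mulmxA vA scalemxAr.
pose A1 := A - a *: P.
(* The two-sided form of [A1] obtained below shows that it inherits positivity from A. *)
have A1s : A1^T = A1 by rewrite /A1 linearB/= linearZ/= As PT.
have A1E : A1 = (1%:M - P) *m A *m (1%:M - P).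
  rewrite !mulmxBr !mulmxBl !mul1mx !mulmx1 PA AP -scalemxAl PP subrr subr0.
  by [].
have A1psd : psd A1.
  split => // w; rewrite A1E.
  have := A0 ((1%:M - P) *m w).
  by rewrite trmx_mul linearB/= trmx1 PT !mulmxA.
have A1v : A1 *m v = 0 by rewrite mulmxBl Av -scalemxAl -mulmxA vv mulmx1 subrr.
have rA1 : (\rank A1 < \rank A)%N.
  apply: rank_ltmx; apply/andP; split.
    have -> : A1 = (1%:M - P) *m A by rewrite mulmxBl mul1mx PA.
    exact: submxMl.
  (* With equal row spaces A = D A1, hence A v = 0 because A1 v = 0; this contradicts A v = a v with
     a > 0. *)
  apply/negP => /submxP[D AD]; have := Av; rewrite AD -mulmxA A1v mulmx0.
  move=> /esym/eqP; rewrite scaler_eq0 (gt_eqF a0)/= => /eqP v0.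
  by have := v1; rewrite v0 /qform mulmx0 mxE => /eqP; rewrite eq_sym oner_eq0.
have [S [[Ss S0] SS]] := IH A1 (leq_trans rA1 Ak) A1psd.
(* |S v|^2 = v^T A1 v = 0. Hence S P = P S = 0, and the cross terms in the square of S + sqrt(a) P
   disappear. *)
have Sv : S *m v = 0.
  apply: qform1_eq0; rewrite /qform mulmx1 trmx_mul Ss mulmxA -(mulmxA _ S S) SS.
  by rewrite -mulmxA A1v mulmx0 mxE.
have vS : v^T *m S = 0 by rewrite -[LHS]trmxK trmx_mul trmxK Ss Sv trmx0.
exists (S + Num.sqrt a *: P); split; first split.
- by rewrite linearD/= linearZ/= Ss PT.
- move=> w; rewrite mulmxDr mulmxDl mxE addr_ge0// -scalemxAr -scalemxAl mxE.
  rewrite mulr_ge0 ?sqrtr_ge0// /P !mulmxA.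
  have -> : w^T *m v = (v^T *m w)^T by rewrite trmx_mul trmxK.
  by rewrite -mulmxA mxE big_ord1 mxE -expr2 sqr_ge0.
- rewrite mulmxDr !mulmxDl SS -!scalemxAl -!scalemxAr PP scalerA -expr2.
  rewrite sqr_sqrtr ?ltW// {1 2}/P mulmxA Sv mul0mx -mulmxA vS mulmx0 !scaler0.
  by rewrite addr0 add0r subrK.
Qed.

Lemma psd_sqrtP A : psd A -> psd (psd_sqrt A) /\ psd_sqrt A *m psd_sqrt A = A.
Proof.
move=> /psd_sqrt_ex[S SA].
exact: (@xgetPex _ 0 [set S | psd S /\ S *m S = A] (ex_intro _ S SA)).
Qed.

(** This removes the chosen root from all later arguments: the right-hand side depends on the
    entries of A in an explicit way. *)
Lemma enorm_psd_sqrt A v : psd A ->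
  enorm (psd_sqrt A *m v) = Num.sqrt (qform A v v).
Proof.
move=> /psd_sqrtP[[Ss _] SS]; rewrite /enorm; congr Num.sqrt.
transitivity (qform 1%:M (psd_sqrt A *m v) (psd_sqrt A *m v)).
  by rewrite qform1; apply: eq_bigr => i _; rewrite big_ord1.
by rewrite /qform mulmx1 trmx_mul Ss mulmxA -(mulmxA _ (psd_sqrt A) (psd_sqrt A)) SS.
Qed.

Lemma qform_cauchy A u v : psd A -> qform A u v ^+ 2 <= qform A u u * qform A v v.
Proof.
move=> /[dup] Apsd [As A0].
have [v0|vn0] := eqVneq (qform A v v) 0.
  by rewrite v0 mulr0 /qform -mulmxA psd_null// mulmx0 mxE expr0n.
have v0 : 0 < qform A v v by rewrite lt0r vn0; exact: A0.
have := A0 (u - (qform A u v / qform A v v) *: v); rewrite -/(qform A _ _).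
rewrite -scaleNr qformDl !qformDr !qformZl !qformZr (qformC v u)//.
move=> H; rewrite -subr_ge0.
suff -> : qform A u u * qform A v v - qform A u v ^+ 2 =
  (qform A u u + - (qform A u v / qform A v v) * qform A u v +
  (- (qform A u v / qform A v v) * qform A u v + - (qform A u v / qform A v v) *
  (- (qform A u v / qform A v v) * qform A v v))) * qform A v v.
  by rewrite mulr_ge0// ltW.
by field.
Qed.

Lemma sqrt_qformD A u v : psd A ->
  Num.sqrt (qform A (u + v) (u + v)) <=
  Num.sqrt (qform A u u) + Num.sqrt (qform A v v).
Proof.
move=> /[dup] Apsd [As A0].
have q0 w : 0 <= qform A w w by exact: A0.
rewrite -[leRHS]ger0_norm ?addr_ge0 ?sqrtr_ge0// -sqrtr_sqr ler_wsqrtr//.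
rewrite sqrrD !sqr_sqrtr// qformDl !qformDr (qformC v u)//.
have : qform A u v <= Num.sqrt (qform A u u) * Num.sqrt (qform A v v).
  rewrite -sqrtrM// (le_trans (ler_norm _))// -sqrtr_sqr ler_wsqrtr//.
  exact: qform_cauchy.
by rewrite mulr2n; lra.
Qed.

Lemma sqrt_qformZ A a v :
  Num.sqrt (qform A (a *: v) (a *: v)) = `|a| * Num.sqrt (qform A v v).
Proof. by rewrite qformZl qformZr mulrA -expr2 sqrtrM ?sqr_ge0// sqrtr_sqr. Qed.

End psd_square_root.

(** * Almost everywhere differentiability on the line *)

Section monotone_nonexpansive.
Context {R : realType}.
Local Notation mu := (@lebesgue_measure R).

(** The two monotonicities together say that h increases by at most the increment of its argument,
    so h is 1-Lipschitz. Right continuity is what a Stieltjes measure asks for. *)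
Lemma nonexpansive_right_continuous (h : R -> R) :
  {homo h : x y / x <= y} -> {homo (fun x => x - h x) : x y / x <= y} ->
  right_continuous h.
Proof.
move=> hnd hnd' x; apply: cvg_at_right_filter.
apply/cvgrPdist_le => e e0; near=> y.
have : `|x - y| <= e by near: y; apply: cvgr_dist_le => //; exact: cvg_id.
apply: le_trans.
have [xy|yx] := leP x y.
  have := hnd _ _ xy; have /= := hnd' _ _ xy => A B.
  rewrite !ler0_norm ?subr_le0//; lra.
have := hnd _ _ (ltW yx); have /= := hnd' _ _ (ltW yx) => A B.
rewrite !ger0_norm ?subr_ge0//; [lra|exact/ltW].
Unshelve. all: by end_near. Qed.

(* The Lebesgue-Stieltjes measures of h and of x - h add up to the Lebesgue
   measure, so that of h is absolutely continuous. *)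
Lemma nonexpansive_ae_derivable (h : R -> R) :
  {homo h : x y / x <= y} -> {homo (fun x => x - h x) : x y / x <= y} ->
  {ae mu, forall x, derivable h x 1}.
Proof.
move=> hnd hnd'.
have hrc := nonexpansive_right_continuous hnd hnd'.
have hrc' : right_continuous (fun x => x - h x).
  apply: nonexpansive_right_continuous => // x y xy /=.
  by rewrite !subKr; exact: hnd.
pose H : cumulative R R := HB.pack h (isCumulative.Build R _ R h hnd hrc).
pose H' : cumulative R R := HB.pack (fun x => x - h x)
  (isCumulative.Build R _ R (fun x => x - h x) hnd' hrc').
have LSE (f : cumulative R R) a b : a <= b ->
    lebesgue_stieltjes_measure f `]a, b]%classic = (f b - f a)%:E.
  move=> ab; rewrite /lebesgue_stieltjes_measure /measure_extension.
  rewrite measurable_mu_extE//=; last exact: is_ocitv.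
  by rewrite wlength_itv_bnd.
have LSH : forall A : set (measurableTypeR R), measurable A ->
    mu A = (lebesgue_stieltjes_measure H A + lebesgue_stieltjes_measure H' A)%E.
  move=> A mA.
  pose m := measure_add (lebesgue_stieltjes_measure H)
    (lebesgue_stieltjes_measure H').
  have mE B : m B = (lebesgue_stieltjes_measure H B +
    lebesgue_stieltjes_measure H' B)%E by rewrite /m measure_addE.
  rewrite -mE; apply: (@lebesgue_measure_unique _ m) => //.
  move=> X [[a b]] _ <-; apply: etrans (esym (mE _)) => /=.
  have [ab|ba] := leP a b; last first.
    rewrite set_itv_ge ?bnd_simp -?leNgt ?ltW//.
    by rewrite !(measure0 (lebesgue_stieltjes_measure _)) adde0.
  rewrite !LSE// -EFinD /lebesgue_measure LSE//=; congr EFin; rewrite /idfun; lra.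
have LSle A : measurable A -> (lebesgue_stieltjes_measure H A <= mu A)%E.
  by move=> mA; rewrite LSH// leeDl.
suff main (k : nat) : {ae mu, forall x, `|x| < k%:R -> derivable h x 1}.
  have : {ae mu, forall x, forall k : nat, `|x| < k%:R -> derivable h x 1}.
    exact/ae_foralln.
  apply: filterS; first exact: (ae_filter_ringOfSetsType mu).
  move=> x; apply.
  exact: (truncnS_gt `|x|).
(* The Stieltjes measure of h may be infinite on the line; restricted to ]-k, k] it is finite, as
   the density theorem requires. *)
pose D : set (measurableTypeR R) := `]- k%:R, k%:R]%classic.
have mD : measurable D by exact: measurable_itv.
have Doo : (lebesgue_stieltjes_measure H D < +oo)%E.
  by rewrite LSE ?ltry// ge0_cp.
pose nu : {finite_measure set (measurableTypeR R) -> \bar R} := mfrestr mD Doo.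
have numu : nu `<< mu.
  apply/null_content_dominatesP => A mA muA0; apply/eqP.
  rewrite eq_le measure_ge0 andbT /= /nu /= /mfrestr /mrestr.
  rewrite -muA0 (le_trans (LSle _ _)) ?le_measure ?inE//; exact: measurableI.
have [g [g0 gfin gint gE]] := radon_nikodym_sigma_finite numu.
pose phi := fine \o g.
have gphi : g = EFin \o phi by apply/funext => x /=; rewrite /phi /= fineK.
rewrite gphi in gint.
have locphi : locally_integrable setT phi.
  rewrite -(patch_setT (fun=> 0) phi); exact: integrable_locally.
have phiint y : mu.-integrable [set` Interval (BRight (- k%:R)) (BRight y)]
    (EFin \o phi).
  by apply: integrableS gint => //; exact: measurable_itv.
have := FTC1 phiint locphi; apply: filterS; first exact: (ae_filter_ringOfSetsType mu).
move=> x + xk.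
rewrite ltr_norml in xk; case/andP: xk => xk1 xk2.
move=> /(_ xk1) [+ _].
pose F y := (\int[mu]_(t in [set` Interval (BRight (- k%:R)) (BRight y)]) phi t)%R.
(* F y is the restricted measure of ]-k, y], so it recovers h up to a constant only for y between -k
   and k. The strict bound |x| < k leaves room for a neighbourhood of x. *)
have FE : {near x, F =1 (fun y => h y - h (- k%:R))}.
  near=> y; have ky : - k%:R <= y.
    by apply/ltW; near: y; exact: lt_nbhsr.
  have yk : y <= k%:R.
    by apply/ltW; near: y; exact: lt_nbhsl.
  rewrite /F /Rintegral.
  transitivity (fine (nu `]- k%:R, y]%classic)).
    congr fine; rewrite gE; last exact: measurable_itv.
    by rewrite gphi.
  rewrite /nu /= /mfrestr /mrestr setIidl ?LSE//.
  by apply: subset_itvl; rewrite bnd_simp.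
move=> /(near_eq_derivable FE) dF.
have -> : h = (fun y => h y - h (- k%:R)) + cst (h (- k%:R)).
  by apply/funext => y /=; rewrite !fctE subrK.
by apply: derivableD => //; exact: derivable_cst.
Unshelve. all: by end_near. Qed.

End monotone_nonexpansive.

Lemma lipschitz_ae_derivable {R : realType} (f : R -> R) (L : R) :
  (forall x y, `|f x - f y| <= L * `|x - y|) ->
  {ae @lebesgue_measure R, forall x, derivable f x 1}.
Proof.
move=> fL; pose M := Num.max 1 L.
have M0 : 0 < M by rewrite lt_max ltr01.
have fM x y : x <= y -> `|f y - f x| / M <= y - x.
  move=> xy; rewrite ler_pdivrMr// (le_trans (fL _ _))// ger0_norm ?subr_ge0//.
  by rewrite mulrC ler_wpM2l ?subr_ge0// le_max lexx orbT.
have fM' x y : x <= y -> x - y <= f y / M - f x / M <= y - x.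
  move=> /fM; rewrite -[X in _ / X](gtr0_norm M0) -normf_div ler_norml mulrBl.
  by rewrite opprB.
(* f / M has slopes in [-1, 1], so h has slopes in [0, 1], and f is a linear combination of h and
   the identity. *)
pose h x := (x + f x / M) / 2.
have : {ae @lebesgue_measure R, forall x, derivable h x 1}.
  apply: nonexpansive_ae_derivable => x y /fM' => /andP[A B]; rewrite /h; lra.
apply: filterS; first exact: (ae_filter_ringOfSetsType lebesgue_measure).
move=> x dh.
have -> : f = (2 * M) *: h + (- M) *: id.
  apply/funext => y; rewrite !fctE /h /GRing.scale /=.
  by field; exact/lt0r_neq0.
apply: derivableD; apply: derivableZ => //.
Qed.

(** * Lebesgue outer measure and slices *)

Section tuple_lebesgue_measure.
Context {R : realType}.
Local Notation X := (measurableTypeR R).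
Local Notation mu := (@lebesgue_measure R).

Definition tuple_box n (a b : 'I_n -> R) : set (n.-tuple X) :=
  [set y | forall i, a i < tnth y i <= b i].

Lemma measurable_tuple_box n (a b : 'I_n -> R) : measurable (tuple_box a b).
Proof.
rewrite (_ : tuple_box a b = \bigcap_(i in [set: 'I_n])
  ((fun y : n.-tuple X => tnth y i) @^-1` `]a i, b i]%classic)); last first.
  apply/seteqP; split=> [y ab i _ /=|y ab i]; first by rewrite in_itv/=; exact: ab.
  by have := ab i I; rewrite /= in_itv.
apply: fin_bigcap_measurable => // i _; rewrite -[X in measurable X]setTI.
by apply: measurable_tnth => //; exact: measurable_itv.
Qed.

Lemma lebesgue_measure_oc (a b : R) :
  mu `]a, b]%classic = (Num.max 0 (b - a))%:E.
Proof.
rewrite lebesgue_measure_itv/= lte_fin; case: ltP => ab.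
  by rewrite -EFinB max_r// subr_ge0 ltW.
by rewrite max_l// subr_le0.
Qed.

Definition box_product n (P : set (n.-tuple X) -> \bar R) :=
  forall a b, P (tuple_box a b) = (\prod_i Num.max 0 (b i - a i))%:E.

Lemma box_product_sigma_finite n (P : {measure set (n.-tuple X) -> \bar R}) :
  box_product P -> sigma_finite setT P.
Proof.
move=> PE; exists (fun k => tuple_box (fun=> - k%:R) (fun=> k%:R)); last first.
  by move=> k; rewrite PE ltry; split => //; exact: measurable_tuple_box.
apply/seteqP; split => // y _.
pose k := (\max_i (Num.truncn `|tnth y i|).+1)%N.
exists k => // i; have : `|tnth y i| < k%:R.
  rewrite (lt_le_trans (truncnS_gt _))// ler_nat /k.
  exact: (@leq_bigmax _ (fun i => (Num.truncn `|tnth y i|).+1) i).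
by rewrite ltr_norml => /andP[-> /ltW].
Qed.

Definition tuple_cons n (xy : X * n.-tuple X) : n.+1.-tuple X :=
  [tuple of xy.1 :: xy.2].

Lemma measurable_tuple_cons n : measurable_fun setT (@tuple_cons n).
Proof. exact: measurable_cons. Qed.

(** The n-fold product measure is built by induction: dirac mass on the empty tuple, then the
    product with one-dimensional Lebesgue measure, transported by [tuple_cons]. Sigma-finiteness is
    carried along because the next product needs it. *)
Lemma tuple_measure_ex n :
  exists P : {sigma_finite_measure set (n.-tuple X) -> \bar R}, box_product P.
Proof.
elim: n => [|n [P PE]].
  pose P : {measure set (0.-tuple X) -> \bar R} := dirac [tuple].
  have PE : box_product P.
    move=> a b; rewrite big_ord0 /P /= diracE mem_set// => i.
    by have := ltn_ord i.
  pose P' : {sigma_finite_measure set (0.-tuple X) -> \bar R} := HB.pack (P : set _ -> _)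
   (Measure.on P) (Measure_isSigmaFinite.Build _ _ _ P (box_product_sigma_finite PE)).
  by exists P'.
(* The measurability proof that the canonical measure structure of [pushforward]
   takes as an argument cannot be inferred, so the instance is named explicitly. *)
pose P1 : {measure set (n.+1.-tuple X) -> \bar R} :=
  measure_function_pushforward__canonical__measure_function_Measure
    (mu \x P)%E (@measurable_tuple_cons n).
have P1E : box_product P1.
  move=> a b; rewrite /P1 /= /pushforward.
  rewrite (_ : _ @^-1` _ = `]a ord0, b ord0]%classic `*`
      tuple_box (fun i => a (lift ord0 i)) (fun i => b (lift ord0 i))); last first.
    apply/seteqP; split => [[x y] /= ab|[x y] /= [ab0 ab] i].
      split; first by have := ab ord0; rewrite in_itv.
      by move=> i; have := ab (lift ord0 i); rewrite tnthS.
    by case: (unliftP ord0 i) => [j|] ->; [rewrite tnthS; exact: ab|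
      rewrite in_itv in ab0].
  rewrite product_measure1E ?measurable_itv//; last exact: measurable_tuple_box.
  rewrite big_ord_recl EFinM; congr (_ * _)%E; last exact: PE.
  exact: lebesgue_measure_oc.
pose P' : {sigma_finite_measure set (n.+1.-tuple X) -> \bar R} :=
  HB.pack (P1 : set _ -> _) (Measure.on P1)
  (Measure_isSigmaFinite.Build _ _ _ P1 (box_product_sigma_finite P1E)).
by exists P'.
Qed.

End tuple_lebesgue_measure.

(** * Boxes: Caratheodory measurability, volume, and comparison with the product measure *)

Section lebesgue_boxes.
Context {R : realType} {n : nat}.
Local Notation E := 'rV[R]_n.+1.
Local Notation X := (measurableTypeR R).
Local Notation leb := (@lebesgue_outer R n).
Local Notation T := (caratheodory_type leb).
Local Notation B := (g_sigma_algebraType (range (@box R n))).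

Lemma boxI (c d : E * E) :
  box c `&` box d = box (\row_i Num.max (c.1 ord0 i) (d.1 ord0 i),
                         \row_i Num.min (c.2 ord0 i) (d.2 ord0 i)).
Proof.
apply/seteqP; split => [x [cx dx] i|x cdx].
  by rewrite !mxE gt_max le_min; move: (cx i) (dx i) => /andP[-> ->] /andP[-> ->].
by split => i; have := cdx i; rewrite !mxE gt_max le_min => /andP[/andP[? ?] /andP[? ?]];
  apply/andP.
Qed.

Lemma box_setI_closed : setI_closed (range (@box R n)).
Proof. by move=> _ _ [c _ <-] [d _ <-]; rewrite boxI; exact: imageT. Qed.

Lemma lebesgue_outer_box_le (c : E * E) : (leb (box c) <= (box_vol c)%:E)%E.
Proof.
apply: ereal_inf_lbound; exists (fun k => if k == 0%N then c else (0, 0)).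
  by move=> x cx; exists 0%N.
rewrite (nneseries_split 0 1)//; last first.
  by move=> k _; rewrite lee_fin box_vol_ge0.
rewrite add0n big_nat1 eseries0 ?adde0// => -[|k]// _ _; congr EFin.
by rewrite /box_vol (bigD1 ord0)//= subrr maxxx mul0r.
Qed.

(** Cut every box of a cover along the hyperplane: the two parts cover the two parts of the set, and
    their volumes add up. If the hyperplane misses a box, [Num.min] and [Num.max] make one part
    degenerate, with volume 0. *)
Lemma halfspace_caratheodory (i : 'I_n.+1) (a : R) :
  leb.-caratheodory [set x : E | x ord0 i <= a].
Proof.
apply: le_caratheodory_measurable => A.
apply: le_ereal_inf_tmp => _ [c Ac <-].
pose cl k : E * E := ((c k).1,
  \row_j if j == i then Num.min a ((c k).2 ord0 j) else (c k).2 ord0 j).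
pose cr k : E * E := (\row_j if j == i then Num.max a ((c k).1 ord0 j)
  else (c k).1 ord0 j, (c k).2).
have vol k : box_vol (c k) = box_vol (cl k) + box_vol (cr k).
  rewrite /box_vol (bigD1 i)//= [X in _ = X + _](bigD1 i)//=.
  rewrite [X in _ = _ + X](bigD1 i)//= !mxE eqxx.
  under [X in _ = _ * X + _]eq_bigr => j ji do rewrite !mxE (negbTE ji).
  under [X in _ = _ + _ * X]eq_bigr => j ji do rewrite !mxE (negbTE ji).
  rewrite -mulrDl; congr (_ * _).
  by rewrite /Num.max /Num.min; do !case: ifPn; rewrite -?leNgt => *; lra.
under eq_eseriesr do rewrite vol EFinD.
rewrite nneseriesD; [|by move=> *; rewrite lee_fin box_vol_ge0..].
apply: leeD; apply: ereal_inf_lbound.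
  exists cl => // x [/Ac[k _ cx] /= xa]; exists k => // j.
  rewrite /cl /= !mxE; have /andP[-> ?] := cx j.
  by case: eqP => [->|//]; rewrite le_min xa; have /andP[] := cx i.
exists cr => // x [/Ac[k _ cx] /= /negP]; rewrite -ltNge => xa; exists k => // j.
rewrite /cr /= !mxE; have /andP[? ->] := cx j; rewrite andbT.
by case: eqP => [->|//]; rewrite gt_max xa; have /andP[] := cx i.
Qed.

Lemma box_caratheodory (c : E * E) : lebesgue_measurable (box c).
Proof.
rewrite (_ : box c = \bigcap_(i in [set: 'I_n.+1])
  ([set x : T | x ord0 i <= c.2 ord0 i] `\` [set x : T | x ord0 i <= c.1 ord0 i])).
  apply: fin_bigcap_measurable => // i _.
  apply: measurableD; exact: halfspace_caratheodory.
apply/seteqP; split => [x cx i _|x cx i].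
  by have /andP[? ?] := cx i; split => //=; apply/negP; rewrite -ltNge.
by have [-> /negP] := cx i I; rewrite -ltNge => ->.
Qed.

Lemma lebesgue_measurable_box_sigma (A : set B) :
  measurable A -> lebesgue_measurable A.
Proof.
apply: smallest_sub; first exact: sigma_algebra_measurable.
by move=> _ [c _ <-]; exact: box_caratheodory.
Qed.

(** The i-th coordinate is the second component of the pair, so that sections over the first
    component are lines parallel to the i-th axis. *)
Definition row_insert (i : 'I_n.+1) (ya : n.-tuple X * X) : B :=
  \row_j if unlift i j is Some k then tnth ya.1 k else ya.2.

Lemma row_insert_box i (c : E * E) :
  row_insert i @^-1` box c =
  tuple_box (fun k => c.1 ord0 (lift i k)) (fun k => c.2 ord0 (lift i k)) `*`
  `]c.1 ord0 i, c.2 ord0 i]%classic.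
Proof.
apply/seteqP; split => [[y a] /= cya|[y a] /= [cy ca] j].
  split => [k|]; first by have := cya (lift i k); rewrite mxE liftK.
  by have := cya i; rewrite mxE unlift_none in_itv.
by rewrite mxE; case: unliftP => [k|] -> //; exact: cy.
Qed.

Lemma measurable_row_insert i : measurable_fun setT (row_insert i).
Proof.
apply: (@measurability _ _ _ B _ _ (range (@box R n))) => // _ [_ [c _ <-] <-].
rewrite setTI row_insert_box; apply: measurableX; last exact: measurable_itv.
exact: measurable_tuple_box.
Qed.

(** M is the image of the product measure under [row_insert i]. A product measure is by definition
    the integral of the measures of the sections, which is the Tonelli formula in the statement. *)
Lemma slice_measure_ex (i : 'I_n.+1) :
  exists (P : {sigma_finite_measure set (n.-tuple X) -> \bar R})
         (M : {measure set B -> \bar R}),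
  (forall A, M A = \int[P]_y (@lebesgue_measure R) (fun a => A (row_insert i (y, a))))%E /\
  (forall c, M (box c) = (box_vol c)%:E).
Proof.
have [P PE] := @tuple_measure_ex R n.
exists P, (measure_function_pushforward__canonical__measure_function_Measure
    (P \x @lebesgue_measure R)%E (@measurable_row_insert i)).
split=> [A|c].
  apply: eq_integral => y _ /=; congr lebesgue_measure.
  by apply/seteqP; split => a; rewrite /xsection /= inE.
rewrite /= /pushforward row_insert_box product_measure1E; last 2 first.
  exact: measurable_tuple_box.
  exact: measurable_itv.
rewrite /box_vol (bigD1_ord i)//= mulrC EFinM; congr (_ * _)%E; first exact: PE.
exact: lebesgue_measure_oc.
Qed.

(** Countable subadditivity of M along each cover by boxes. Applied to the product measure, it
    yields the lower bound for the outer measure of a box without a compactness argument on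
    covers. *)
Lemma lebesgue_outer_ge (M : {measure set B -> \bar R}) :
  (forall c, M (box c) = (box_vol c)%:E) ->
  forall A : set B, measurable A -> (M A <= leb A)%E.
Proof.
move=> Mbox A mA; apply: le_ereal_inf_tmp => _ [c Ac <-].
under eq_eseriesr do rewrite -Mbox.
apply: measure_sigma_subadditive => // k.
by apply: sub_sigma_algebra; exists (c k).
Qed.

Lemma lebesgue_outer_box (c : E * E) : leb (box c) = (box_vol c)%:E.
Proof.
apply/eqP; rewrite eq_le lebesgue_outer_box_le/=.
have [P [M [_ Mbox]]] := slice_measure_ex ord0.
rewrite -Mbox; apply: lebesgue_outer_ge => //.
by apply: sub_sigma_algebra; exists c.
Qed.

(** Boxes are stable under intersection and the cubes ]-k, k]^N exhaust the space, so measures that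
    agree on boxes agree on the sigma-algebra they generate. *)
Lemma box_measure_unique (M : {measure set B -> \bar R}) :
  (forall c, M (box c) = (box_vol c)%:E) ->
  forall A : set B, measurable A -> M A = leb A.
Proof.
move=> Mbox A mA.
have mid : measurable_fun [set: T] (id : T -> B).
  by move=> _ Y mY; rewrite setTI; exact: lebesgue_measurable_box_sigma.
pose L : {measure set B -> \bar R} :=
  measure_function_pushforward__canonical__measure_function_Measure
    (@lebesgue_rV R n) mid.
apply: (@measure_unique _ _ B (range (@box R n))
  (fun k => box (const_mx (- k%:R), const_mx k%:R)) _ _ _ _ M L) => //.
- exact: box_setI_closed.
- apply/seteqP; split => // x _.
  exists (Num.truncn `|x|).+1 => // i; rewrite /= !mxE.
  have : `|x ord0 i| < (Num.truncn `|x|).+1%:R.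
    by rewrite (le_lt_trans (ler_coord_norm _ _))// truncnS_gt.
  by rewrite ltr_norml => /andP[-> /ltW].
- by move=> _ [c _ <-]; rewrite Mbox /L /= /pushforward /lebesgue_rV lebesgue_outer_box.
- by move=> k; rewrite Mbox ltry.
Qed.

Lemma lebesgue_outer_slices0 (i : 'I_n.+1) (A : set B) : measurable A ->
  (forall y, lebesgue_measure (fun a => A (row_insert i (y, a))) = 0%E) -> leb A = 0%E.
Proof.
move=> mA A0; have [P [M [ME Mbox]]] := slice_measure_ex i.
rewrite -(box_measure_unique Mbox mA) ME.
by under eq_integral do rewrite A0; rewrite integral0.
Qed.

End lebesgue_boxes.

(** * Open, closed, bounded and null sets under the outer measure *)

Section lebesgue_topology.
Context {R : realType} {n : nat}.
Local Notation E := 'rV[R]_n.+1.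
Local Notation leb := (@lebesgue_outer R n).
Local Notation T := (caratheodory_type leb).
Local Notation B := (g_sigma_algebraType (range (@box R n))).

Definition cube (x : E) (d : R) : set E := box (x - const_mx d, x + const_mx d).

Lemma cube_center (x : E) d : 0 < d -> cube x d x.
Proof. by move=> d0 i; rewrite !mxE /=; apply/andP; split; lra. Qed.

Lemma cubeP (x y : E) d : cube x d y -> forall i, `|x ord0 i - y ord0 i| <= d.
Proof. by move=> xy i; move: (xy i); rewrite !mxE ler_norml => /andP[? ?]; lra. Qed.

Lemma open_cube (U : set E) x : open U -> U x ->
  exists2 d, 0 < d & forall y e, cube y e x -> e <= d -> cube y e `<=` U.
Proof.
move=> oU Ux; have : nbhs x U by exact: open_nbhs_nbhs.
rewrite -nbhs_ballE => -[e /= e0 eU].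
(* Two points of a cube of half-width at most e/3 are at distance at most 2e/3 < e. *)
exists (e / 3); first by rewrite divr_gt0.
move=> y d yx de z yz; apply: eU; rewrite mx_norm_ball /ball_ /=.
apply: (@le_lt_trans _ _ (2 * (e / 3))); last by move: e0 => /=; lra.
apply: mx_norm_le => [|i]; first by move: e0 => /=; lra.
rewrite !mxE; have := cubeP yx i; have := cubeP yz i.
by rewrite !ler_norml => /andP[? ?] /andP[? ?]; apply/andP; split; lra.
Qed.

Lemma open_box_sigma (U : set B) : open (U : set E) -> measurable U.
Proof.
move=> oU.
(* An open set is the union of the cubes with rational centre and half-width 1/(k+1) that it
   contains; the other indices contribute the empty set. *)
pose F (qk : 'rV[rat]_n.+1 * nat) : set B :=
  let C := cube (map_mx ratr qk.1) qk.2.+1%:R^-1 in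
  if `[< C `<=` U >] then C else set0.
have -> : U = \bigcup_qk F qk.
  apply/seteqP; split=> [x Ux|x [qk _]]; last first.
    by rewrite /F; case: asboolP => // CU /CU.
  have [d d0 dU] := open_cube oU Ux.
  pose k := Num.truncn d^-1.
  have kd : k.+1%:R^-1 <= d.
    rewrite -[leRHS]invrK lef_pV2 ?posrE ?invr_gt0// ltW//.
    exact: truncnS_gt.
  have k0 : 0 < k.+1%:R^-1 :> R by rewrite invr_gt0.
  have /choice[q qx] : forall i, exists q : rat,
      x ord0 i - k.+1%:R^-1 < ratr q < x ord0 i + k.+1%:R^-1.
    move=> i; have /rat_in_itvoo[q] : x ord0 i - k.+1%:R^-1 < x ord0 i + k.+1%:R^-1.
      by rewrite ltrBlDr -addrA ltrDl addr_gt0.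
    by rewrite in_itv/=; exists q.
  have Cx : cube (map_mx ratr (\row_i q i)) k.+1%:R^-1 x.
    move=> i; rewrite !mxE /=; move/andP: (qx i) => [? ?].
    by apply/andP; split; [rewrite ltrBlDr|rewrite -lerBlDr ltW].
  exists (\row_i q i, k) => //; rewrite /F /=; case: asboolP => // -[].
  exact: dU.
apply: countable_bigcupT_measurable => // qk; rewrite /F; case: asboolP => // _.
by apply: sub_sigma_algebra; exact: imageT.
Qed.

Lemma closed_box_sigma (U : set B) : closed (U : set E) -> measurable U.
Proof.
move=> cU; rewrite -(setCK U); apply: measurableC.
by apply: open_box_sigma; exact: closed_openC.
Qed.

Lemma open_lebesgue_measurable (U : set E) : open U -> lebesgue_measurable U.
Proof. by move=> ?; apply: lebesgue_measurable_box_sigma; exact: open_box_sigma. Qed.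

Lemma continuous_lebesgue_measurable (A : set T) (f : E -> R) :
  measurable A -> continuous f -> measurable_fun A (f : T -> R).
Proof.
move=> mA /continuousP cf; apply: (measurability _ (RGenOpens.measurableE R)).
move=> _ [_ [a [b ->] <-]]; apply: measurableI => //.
by apply: open_lebesgue_measurable; exact/cf/interval_open.
Qed.

Lemma lebesgue_outer_open_gt0 (U : set E) : open U -> U !=set0 -> (0 < leb U)%E.
Proof.
move=> oU [x Ux]; have [d d0 dU] := open_cube oU Ux.
apply: (@lt_le_trans _ _ (leb (cube x d))); last first.
  by apply: le_lebesgue_outer; apply: dU => //; exact: cube_center.
rewrite lebesgue_outer_box lte_fin; apply: prodr_gt0 => i _.
by rewrite lt_max !mxE; apply/orP; right; lra.
Qed.

Lemma lebesgue_outer_bounded (A : set E) : bounded_set A -> (leb A < +oo)%E.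
Proof.
move=> [M [_ /(_ (M + 1))]]; rewrite ltrDl ltr01 => /(_ isT) AM.
apply: (@le_lt_trans _ _ (leb (cube 0 (M + 2)))); last by rewrite lebesgue_outer_box ltry.
apply: le_lebesgue_outer => x /AM xM i; rewrite !mxE.
have := le_trans (ler_coord_norm x i) xM.
by rewrite ler_norml => /andP[? ?]; apply/andP; split => /=; lra.
Qed.

Lemma lebesgue_null_measurable (A : set E) : leb A = 0%E -> lebesgue_measurable A.
Proof.
move=> A0; apply: le_caratheodory_measurable => C.
rewrite [X in (X + _ <= _)%E](_ : _ = 0%E) ?add0e; last first.
  by apply/eqP; rewrite eq_le lebesgue_outer_ge0 andbT -A0 le_lebesgue_outer.
exact: le_lebesgue_outer.
Qed.

End lebesgue_topology.

(** * Partial derivatives of Lipschitz functions *)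

Section difference_quotients.
Context {R : realType} {V : normedModType R}.
Implicit Types (f : V -> R) (x v : V).

Definition diff_quot f v (h : R) x : R := h^-1 *: (f (h *: v + x) - f x).

(* By the Cauchy criterion, f is derivable at x in the direction v iff for every
   m some l satisfies [diff_quot_close f v m l x]; these sets are closed, which
   makes the set of derivability Borel. *)
Definition diff_quot_close f v (m l : nat) : set V :=
  \bigcap_(hk in [set hk : R * R | 0 < `|hk.1| < l.+1%:R^-1 /\ 0 < `|hk.2| < l.+1%:R^-1])
    [set x | `|diff_quot f v hk.1 x - diff_quot f v hk.2 x| <= m.+1%:R^-1].

Lemma derivable_diff_quotP f x v :
  derivable f x v <-> forall m, exists l, diff_quot_close f v m l x.
Proof.
split=> [/cvg_ex[/= d fd] m|fc].
  have m0 : 0 < m.+1%:R^-1 / 2 :> R by rewrite divr_gt0 ?invr_gt0.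
  move/cvgrPdist_le : fd => /(_ _ m0) [e /= e0 ed].
  exists (Num.truncn e^-1) => -[h k] /= [/andP[h0 hl] /andP[k0 kl]].
  have le : (Num.truncn e^-1).+1%:R^-1 <= e.
    by rewrite -[leRHS]invrK lef_pV2 ?posrE ?invr_gt0// ltW// truncnS_gt.
  have H j : 0 < `|j| -> `|j| < (Num.truncn e^-1).+1%:R^-1 ->
      `|d - diff_quot f v j x| <= m.+1%:R^-1 / 2.
    move=> j0 jl; apply: ed => /=; last by rewrite -normr_gt0.
    by rewrite sub0r normrN (lt_le_trans jl).
  rewrite (le_trans (ler_distD d _ _))// [leRHS](splitr m.+1%:R^-1).
  by rewrite lerD ?H// distrC H.
apply: cauchy_cvg; apply: cauchy_exP => e e0.
have [l xl] := fc (Num.truncn e^-1).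
have l0 : 0 < l.+1%:R^-1 :> R by rewrite invr_gt0.
(* Half of 1/(l+1) is an admissible increment, so all quotients with smaller increments than 1/(l+1)
   lie within 1/(m+1) < e of this one. *)
exists (diff_quot f v (l.+1%:R^-1 / 2) x).
have h0 : 0 < l.+1%:R^-1 / 2 :> R by rewrite divr_gt0.
exists l.+1%:R^-1 => //= k /= ; rewrite sub0r normrN => kl k0.
have := xl (l.+1%:R^-1 / 2, k); rewrite /= gtr0_norm// h0 normr_gt0 k0 kl.
rewrite ltr_pdivrMr// ltr_pMr// ltr1n => /(_ (conj isT isT)) /le_lt_trans; apply.
rewrite -[ltRHS]invrK ltf_pV2 ?posrE ?invr_gt0//.
exact: truncnS_gt.
Qed.

Lemma diff_quot_continuous f v h : continuous f -> continuous (diff_quot f v h).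
Proof.
move=> cf x; apply: cvgZr; apply: cvgB; last exact: cf.
apply: (@cvg_comp _ _ _ (fun x => h *: v + x) f _ (nbhs (h *: v + x))); last exact: cf.
by apply: cvgD; [exact: cvg_cst|exact: cvg_id].
Qed.

Lemma diff_quot_close_closed f v m l : continuous f -> closed (diff_quot_close f v m l).
Proof.
move=> cf; apply: closed_bigI => -[h k] _ /=.
rewrite [X in closed X](_ : _ = (fun x => `|diff_quot f v h x - diff_quot f v k x|)
  @^-1` [set y | y <= m.+1%:R^-1])//.
apply: preimage_closed; last exact: closed_le.
move=> x _; apply: cvg_norm; apply: cvgB; exact: diff_quot_continuous.
Qed.

End difference_quotients.

Section lipschitz_functions.
Context {R : realType} {V : normedModType R}.

Lemma lipschitz_bound (f : V -> R) : lipschitz f ->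
  exists2 L, 0 < L & forall x y, `|f x - f y| <= L * `|x - y|.
Proof.
move=> [M [_ HM]]; exists (Num.max 1 (M + 1)); first by rewrite lt_max ltr01.
have ML : M < Num.max 1 (M + 1) by rewrite lt_max ltrDl ltr01 orbT.
by move=> x y; exact: (HM _ ML (x, y) (conj I I)).
Qed.

Lemma bound_lipschitz (f : V -> R) L :
  (forall x y, `|f x - f y| <= L * `|x - y|) -> lipschitz f.
Proof.
move=> fL; apply: (@klipschitzW _ _ _ L); last by move=> [x y] _; exact: fL.
by apply: (@globally_properfilter _ _ (0, 0)).
Qed.

Lemma lipschitz_continuous (f : V -> R) : lipschitz f -> continuous f.
Proof.
move=> /lipschitz_bound[L L0 fL] x; apply/cvgrPdist_le => e e0; near=> y.
rewrite (le_trans (fL _ _))// mulrC -ler_pdivlMr//.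
near: y; apply: (@cvgr_dist_le _ _ _ _ _ id x); first exact: cvg_id.
by rewrite divr_gt0.
Unshelve. all: by end_near. Qed.

Lemma lipschitz_mul (f g : V -> R) (Mf Mg : R) :
  (forall x, `|f x| <= Mf) -> (forall x, `|g x| <= Mg) ->
  lipschitz f -> lipschitz g -> lipschitz (f * g).
Proof.
move=> fM gM /lipschitz_bound[L L0 fL] /lipschitz_bound[K K0 gK].
apply: (@bound_lipschitz _ (Mf * K + L * Mg)) => x y; rewrite !fctE.
have -> : f x * g x - f y * g y = f x * (g x - g y) + (f x - f y) * g y by ring.
rewrite (le_trans (ler_normD _ _))// !normrM mulrDl lerD//.
  by rewrite -mulrA ler_pM.
by rewrite -mulrA (mulrC Mg) mulrA ler_pM.
Qed.

End lipschitz_functions.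

Section partial_derivatives.
Context {R : realType} {n : nat}.
Local Notation E := 'rV[R]_n.+1.
Local Notation leb := (@lebesgue_outer R n).
Local Notation T := (caratheodory_type leb).
Local Notation B := (g_sigma_algebraType (range (@box R n))).
Local Notation e_ := (fun i => delta_mx ord0 i : E).
Implicit Types (f g : E -> R) (i : 'I_n.+1).

Lemma row_insertD i (y : n.-tuple (measurableTypeR R)) (h a : R) :
  row_insert i (y, h + a) = h *: e_ i + row_insert i (y, a) :> E.
Proof.
apply/rowP => j; rewrite !mxE eqxx /=.
by case: unliftP => [k|] ->; rewrite ?eqxx ?mulr1// eq_sym (negbTE (neq_lift _ _)) mulr0 add0r.
Qed.

Lemma norm_row_insert i (y : n.-tuple (measurableTypeR R)) (a b : R) :
  `|row_insert i (y, a) - row_insert i (y, b) : E| <= `|a - b|.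
Proof.
apply: mx_norm_le => // j; rewrite !mxE /=.
by case: unliftP => [k|] _ //; rewrite subrr normr0.
Qed.

(** Expressed by the Cauchy sets instead of [derivable], so that countable operations on closed sets
    show it to be in the sigma-algebra of the boxes. *)
Definition nonderivable f i : set B :=
  ~` \bigcap_m \bigcup_l diff_quot_close f (e_ i) m l.

Lemma nonderivableP f i x : nonderivable f i x <-> ~ derivable f x (e_ i).
Proof.
rewrite derivable_diff_quotP; split; apply: contra_not.
  by move=> H m _; have [l xl] := H m; exists l.
by move=> H m; have [l _ xl] := H m I; exists l.
Qed.

Lemma measurable_nonderivable f i : continuous f -> measurable (nonderivable f i).
Proof.
move=> cf; apply: measurableC; apply: bigcapT_measurable => m.
apply: bigcupT_measurable => l; apply: closed_box_sigma.
exact: diff_quot_close_closed.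
Qed.

(** On each line parallel to the i-th axis the set is where a Lipschitz function of one variable
    fails to be derivable, hence null; null slices make a null set. *)
Lemma nonderivable_null f i : lipschitz f -> leb (nonderivable f i) = 0%E.
Proof.
move=> lf; have [L L0 fL] := lipschitz_bound lf.
have mN := measurable_nonderivable i (lipschitz_continuous lf).
apply: (lebesgue_outer_slices0 (i := i)) => // y.
apply/negligibleP.
  rewrite (_ : (fun a => _) = xsection (row_insert i @^-1` nonderivable f i) y).
    apply: measurable_xsection; rewrite -[X in measurable X]setTI.
    exact: measurable_row_insert.
  by apply/seteqP; split => a; rewrite /xsection /= inE.
have : {ae @lebesgue_measure R, forall a, derivable (fun a => f (row_insert i (y, a))) a 1}.
  apply: (@lipschitz_ae_derivable _ _ L) => a b; rewrite (le_trans (fL _ _))//.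
  by apply: ler_wpM2l; [exact: ltW|exact: norm_row_insert].
apply: negligibleS => a /= /nonderivableP; apply: contra_not.
have E1 : (fun h : R => h^-1 *: ((f \o shift (row_insert i (y, a) : E)) (h *: e_ i) -
    f (row_insert i (y, a)))) = (fun h : R => h^-1 *:
    (((fun a => f (row_insert i (y, a))) \o shift a) (h *: 1) - f (row_insert i (y, a)))).
  by apply/funext => h /=; rewrite -row_insertD [h *: 1]mulr1.
by rewrite /derivable E1.
Qed.

(** Existence of all partial derivatives is asked, not total differentiability: the product rule for
    [grad] is taken coordinate by coordinate. *)
Definition nondiff f : set E := \bigcup_(i in [set: 'I_n.+1]) nonderivable f i.

Lemma measurable_nondiff f : continuous f -> measurable (nondiff f : set B).
Proof.
by move=> cf; apply: fin_bigcup_measurable => // i _; exact: measurable_nonderivable.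
Qed.

Lemma nondiff_null f : lipschitz f -> leb (nondiff f) = 0%E.
Proof.
move=> lf; apply/(@negligibleP _ T _ (@lebesgue_rV R n)).
  apply: lebesgue_measurable_box_sigma; apply: measurable_nondiff.
  exact: lipschitz_continuous.
have -> : nondiff f = \big[setU/set0]_(i <- enum 'I_n.+1) nonderivable f i.
  rewrite -bigcup_seq /nondiff; congr (bigcup _ _).
  by apply/seteqP; split => // i _ /=; rewrite mem_enum.
elim/big_ind : _ => [|A C nA nC|i _]; first exact: negligible_set0.
  exact: (@negligibleU _ T _ (@lebesgue_rV R n)).
apply/negligibleP.
  by apply: lebesgue_null_measurable; exact: nonderivable_null.
exact: nonderivable_null.
Qed.

Lemma nondiffP f x : ~ nondiff f x -> forall i, derivable f x (e_ i).
Proof.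
move=> fx i; apply: contrapT => nd; apply: fx; exists i => //.
exact/nonderivableP.
Qed.

(** Off the null set [nonderivable f i] the derivative is the limit of the continuous difference
    quotients with increments 1/(k+1). On the null set its meaningless values do no harm, since
    every subset of a null set is Lebesgue measurable. *)
Lemma measurable_partial (A : set T) f i : measurable A -> lipschitz f ->
  measurable_fun A (fun x : T => 'D_(e_ i) f x).
Proof.
move=> mA lf; have cf := lipschitz_continuous lf.
apply: measurable_funTS.
have mN : lebesgue_measurable (nonderivable f i).
  by apply: lebesgue_null_measurable; exact: nonderivable_null.
rewrite -(setUv (nonderivable f i)).
apply/measurable_funU; [exact: mN|exact: measurableC mN|split].
  move=> _ Y _; apply: lebesgue_null_measurable.
  apply/eqP; rewrite eq_le lebesgue_outer_ge0 andbT.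
  by rewrite -(nonderivable_null i lf) le_lebesgue_outer.
apply: (@measurable_fun_cvg _ _ _ _
  (fun k (x : T) => diff_quot f (e_ i) k.+1%:R^-1 x)) => [k|x fx].
  apply: continuous_lebesgue_measurable; first exact: measurableC.
  exact: diff_quot_continuous.
have /cvg_ex[d fd] : derivable f x (e_ i).
  by apply: contrapT => /nonderivableP.
have -> : 'D_(e_ i) f x = d by apply: cvg_lim.
apply: (cvg_comp (fun k : nat => k.+1%:R^-1 : R) _ _ fd).
move=> A' [e /= e0 eA]; have /cvgrPdist_lt/(_ _ e0) := @cvg_harmonic R.
apply: filterS => k ke; apply: eA => //=.
Qed.

Lemma measurable_qform (A : set T) (Q : E -> 'M[R]_n.+1) f :
  measurable A -> lipschitz f ->
  (forall i j, measurable_fun A (fun x : T => Q x i j)) ->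
  measurable_fun A (fun x : T => Num.sqrt (qform (Q x) (grad f x) (grad f x))).
Proof.
move=> mA lf mQ.
apply: (@measurableT_comp _ _ _ _ _ _ (@Num.sqrt R)).
  by apply: continuous_measurable_fun; exact: sqrt_continuous.
rewrite (_ : (fun x => _) = fun x : T => \sum_j (\sum_i 'D_(e_ i) f x * Q x i j) *
   'D_(e_ j) f x).
  apply: measurable_sum => j; apply: measurable_funM; last exact: measurable_partial.
  apply: measurable_sum => i.
  by apply: measurable_funM; [exact: measurable_partial|exact: mQ].
apply/funext => x; rewrite /qform mxE; apply: eq_bigr => j _; rewrite !mxE.
by congr (_ * _); apply: eq_bigr => i _; rewrite !mxE.
Qed.

Lemma measurable_wgrad (A : set T) (Q : E -> 'M[R]_n.+1) f :
  measurable A -> lipschitz f -> (forall x, A x -> psd (Q x)) ->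
  (forall i j, measurable_fun A (fun x : T => Q x i j)) ->
  measurable_fun A (wgrad Q f : T -> R).
Proof.
move=> mA lf Qpsd mQ; apply: eq_measurable_fun (measurable_qform mA lf mQ).
by move=> x /set_mem /Qpsd Qx; rewrite /wgrad enorm_psd_sqrt.
Qed.

Lemma wgradM (Q : E -> 'M[R]_n.+1) f g x : psd (Q x) ->
  ~ nondiff f x -> ~ nondiff g x ->
  wgrad Q (f * g) x <= `|f x| * wgrad Q g x + `|g x| * wgrad Q f x.
Proof.
move=> Qx /nondiffP df /nondiffP dg; rewrite /wgrad !enorm_psd_sqrt//.
have -> : grad (f * g) x = f x *: grad g x + g x *: grad f x.
  by apply/matrixP => i j; rewrite !mxE deriveM.
by rewrite -!sqrt_qformZ; exact: sqrt_qformD.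
Qed.

Lemma wgrad_ge0 (Q : E -> 'M[R]_n.+1) f x : 0 <= wgrad Q f x.
Proof. exact: sqrtr_ge0. Qed.

Lemma wgrad_notin_supp (Q : E -> 'M[R]_n.+1) f x : ~ supp f x -> wgrad Q f x = 0.
Proof.
move=> fx; rewrite /wgrad; have -> : grad f x = 0.
  apply/matrixP => i j; rewrite !mxE.
  rewrite (@near_eq_derive _ _ _ f (cst 0)) ?derive_cst//.
  have /nbhs_interior : nbhs x (~` supp f).
    by apply: open_nbhs_nbhs; split => //; exact/closed_openC/closed_closure.
  apply: filterS => y /interior_subset; apply: contra_notP => /eqP fy.
  exact: subset_closure.
rewrite mulmx0 /enorm big1 ?sqrtr0// => i _; rewrite big1// => j _.
by rewrite mxE expr0n.
Qed.

End partial_derivatives.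

(** * Norms on subsets *)

Section Lnorm_inequalities.
Context d {T : measurableType d} {R : realType}.
Variable mu : {measure set T -> \bar R}.
Local Open Scope ereal_scope.
Implicit Types (f g : T -> R) (r : R).
Local Notation "'N_ r [ f ]" := (Lnorm mu r%:E (EFin \o f)).

Lemma measurable_powR_norm (A : set T) f r : measurable_fun A f ->
  measurable_fun A (fun x => (`|f x| `^ r)%R).
Proof.
move=> mf; apply: (@measurableT_comp _ _ _ _ _ _ (@powR R ^~ r)) => //.
exact: measurableT_comp.
Qed.

Lemma measurable_poweR_norm f r : measurable_fun setT f ->
  measurable_fun setT (fun x => `|(EFin \o f) x| `^ r).
Proof.
move=> mf; rewrite (_ : (fun x => _) = EFin \o (fun x => `|f x| `^ r)%R)//.
by apply/measurable_EFinP; exact: measurable_powR_norm.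
Qed.

Lemma le_Lnorm f g r : measurable_fun setT f -> measurable_fun setT g ->
  (0 < r)%R -> {ae mu, forall x, (`|f x| <= `|g x|)%R} -> 'N_r[f] <= 'N_r[g].
Proof.
move=> mf mg r0 fg; rewrite unlock.
have i0 h : 0 <= \int[mu]_x (`|(EFin \o h) x| `^ r).
  by apply: integral_ge0 => x _; exact: poweR_ge0.
apply: gt0_ler_poweR; [by rewrite invr_ge0 ltW|by rewrite in_itv/= i0 leey..|].
apply: ae_ge0_le_integral => //.
- by move=> x _; exact: poweR_ge0.
- exact: measurable_poweR_norm.
- by move=> x _; exact: poweR_ge0.
- exact: measurable_poweR_norm.
apply: filterS fg => x fg _; rewrite lee_fin ge0_ler_powR ?nnegrE//.
exact: ltW.
Qed.

Lemma LnormZ_fun (c : R) f r : measurable_fun setT f -> (0 < r)%R ->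
  'N_r[(fun x => c * f x)%R] = `|c|%:E * 'N_r[f].
Proof.
move=> mf r0; rewrite unlock.
transitivity ((\int[mu]_x ((`|c| `^ r)%:E * (`|(EFin \o f) x| `^ r))) `^ r^-1).
  congr (_ `^ _); apply: eq_integral => x _.
  by rewrite /= normrM powRM.
rewrite ge0_integralZl//; last 2 first.
- exact: measurable_poweR_norm.
- by move=> x _; exact: poweR_ge0.
rewrite poweRM ?lee_fin ?powR_ge0//; last first.
  by apply: integral_ge0 => x _; exact: poweR_ge0.
by rewrite poweR_EFin -powRrM mulfV ?gt_eqF// powRr1.
Qed.

(** The usual inequality with exponents t and u for |f|^p and |g|^p, followed by a p-th root. *)
Lemma Lnorm_hoelder f g (p t u : R) : measurable_fun setT f -> measurable_fun setT g ->
  (0 < p)%R -> (0 < t)%R -> (0 < u)%R -> (t^-1 + u^-1 = 1)%R ->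
  'N_p[(f \* g)%R] <= 'N_(p * t)[f] * 'N_(p * u)[g].
Proof.
move=> mf mg p0 t0 u0 tu.
have Npow (h : T -> R) v : measurable_fun setT h -> (0 < v)%R ->
    'N_v[(fun x => `|h x| `^ p)%R] = 'N_(p * v)[h] `^ p.
  move=> mh v0; rewrite unlock -poweRrM invfM mulrAC mulVf ?gt_eqF// mul1r.
  apply: (congr1 (fun z => z `^ v^-1)); apply: eq_integral => x _ /=.
  by rewrite ger0_norm ?powR_ge0// -powRrM.
have N1 : 'N_1[(fun x => `|(f \* g) x| `^ p)%R] = 'N_p[(f \* g)%R] `^ p.
  rewrite Npow ?mulr1//; exact: measurable_funM.
have H : 'N_p[(f \* g)%R] `^ p <= ('N_(p * t)[f] * 'N_(p * u)[g]) `^ p.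
  rewrite poweRM ?Lnorm_ge0// -(Npow f)// -(Npow g)// -N1.
  apply: le_trans (hoelder mu _ _ t0 u0 tu).
  - apply: le_Lnorm => //.
    + by apply: measurable_powR_norm; exact: measurable_funM.
    + by apply: measurable_funM; exact: measurable_powR_norm.
    + by apply: aeW => x /=; rewrite normrM powRM.
  - exact: measurable_powR_norm.
  - exact: measurable_powR_norm.
have := @gt0_ler_poweR R p^-1 _ _ _ _ _ H.
rewrite -!poweRrM mulfV ?gt_eqF// !poweRe1 ?mule_ge0 ?Lnorm_ge0//; apply.
- by rewrite invr_ge0 ltW.
- by rewrite in_itv/= poweR_ge0 leey.
- by rewrite in_itv/= poweR_ge0 leey.
Qed.

End Lnorm_inequalities.

Section Lnorm_on.
Context d {T : measurableType d} {R : realType}.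
Variable mu : {measure set T -> \bar R}.
Local Open Scope ereal_scope.
Implicit Types (A B : set T) (f g : T -> R) (r : R).
Local Notation "'L_ r [ A , f ]" := (Lnorm mu r%:E ((EFin \o f) \_ A))
  (at level 0, r at level 2).

Let LE A f r : 'L_r[A, f] = Lnorm mu r%:E (EFin \o (f \_ A)).
Proof. by rewrite restrict_EFin. Qed.

Let mr A f : measurable A -> measurable_fun A f ->
  measurable_fun setT ((f : T -> R) \_ A).
Proof.
by move=> mA mf; apply/(measurable_restrict f mA measurableT); rewrite setTI.
Qed.

(** The alternative f x = 0 allows A to leave B; this is how gradients on balls that stick out of
    Theta are compared with gradients on Theta. *)
Lemma le_Lnorm_on A B f g r : measurable A -> measurable B ->
  measurable_fun A f -> measurable_fun B g -> (0 < r)%R ->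
  {ae mu, forall x, A x -> f x = 0%R \/ B x /\ (`|f x| <= `|g x|)%R} ->
  'L_r[A, f] <= 'L_r[B, g].
Proof.
move=> mA mB mf mg r0 fg; rewrite !LE; apply: le_Lnorm => //; [exact: mr|exact: mr|].
apply: filterS fg => x; rewrite !patchE; case: ifPn => [/set_mem Ax /(_ Ax)[->|[Bx fg]]|_ _].
- by rewrite normr0.
- by rewrite mem_set.
- by rewrite normr0.
Qed.

Lemma Lnorm_onD A f g r : measurable A -> measurable_fun A f -> measurable_fun A g ->
  (1 <= r)%R -> 'L_r[A, (f \+ g)%R] <= 'L_r[A, f] + 'L_r[A, g].
Proof.
move=> mA mf mg r1; rewrite !LE.
have -> : ((f \+ g) \_ A = (f \_ A) \+ (g \_ A))%R.
  by apply/funext => x; rewrite /= !patchE; case: ifP => //; rewrite addr0.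
apply: minkowski_EFin => //; exact: mr.
Qed.

Lemma Lnorm_onU A B f r : measurable A -> measurable B -> measurable_fun A f ->
  measurable_fun B f -> (1 <= r)%R -> 'L_r[A `|` B, f] <= 'L_r[A, f] + 'L_r[B, f].
Proof.
move=> mA mB mf mg r1.
have mBA : measurable (B `\` A) by exact: measurableD.
have mf' : measurable_fun (B `\` A) f by apply: (measurable_funS mB) => // x [].
apply: (@le_trans _ _ ('L_r[A, f] + 'L_r[B `\` A, f])).
  rewrite !LE.
  have -> : (f \_ (A `|` B) = (f \_ A) \+ (f \_ (B `\` A)))%R.
    apply/funext => x; rewrite /= !patchE in_setU in_setD.
    by case: (x \in A); case: (x \in B); rewrite /= ?addr0 ?add0r.
  by apply: minkowski_EFin => //; exact: mr.
apply: leeD => //; apply: le_Lnorm_on => //; first exact: lt_le_trans r1.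
by apply: aeW => x [Bx _]; right.
Qed.

Lemma Lnorm_onZ A (c : R) f r : measurable A -> measurable_fun A f -> (0 < r)%R ->
  'L_r[A, (fun x => c * f x)%R] = `|c|%:E * 'L_r[A, f].
Proof.
move=> mA mf r0; rewrite !LE -LnormZ_fun//; last exact: mr.
congr (Lnorm mu _ (EFin \o _)); apply/funext => x; rewrite !patchE.
by case: ifP => //; rewrite mulr0.
Qed.

Lemma Lnorm_on_cst A r : measurable A -> 0 < mu A -> mu A < +oo -> (0 < r)%R ->
  exists2 k : R, (0 < k)%R & forall c : R, 'L_r[A, fun=> c] = (k * `|c|)%:E.
Proof.
move=> mA A0 Aoo r0.
have Afin : mu A \is a fin_num by rewrite ge0_fin_numE.
have L1 : 'L_r[A, fun=> 1%R] = (fine (mu A) `^ r^-1)%:E.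
  rewrite unlock -[in RHS]poweR_EFin fineK//; congr (_ `^ _).
  rewrite -[RHS]mul1e -integral_cst// [RHS]integral_mkcond; apply: eq_integral => x _.
  rewrite !patchE; case: ifP => _ /=; first by rewrite normr1 powR1.
  by rewrite normr0 powR0// gt_eqF.
exists (fine (mu A) `^ r^-1)%R => [|c].
  by rewrite powR_gt0// fine_gt0// A0 Aoo.
transitivity ('L_r[A, (fun=> c * 1)%R]); first by rewrite mulr1.
by rewrite (Lnorm_onZ c mA)// L1 -EFinM mulrC.
Qed.

Lemma Lnorm_on_hoelder A f g (p t u : R) : measurable A ->
  measurable_fun A f -> measurable_fun A g ->
  (0 < p)%R -> (0 < t)%R -> (0 < u)%R -> (t^-1 + u^-1 = 1)%R ->
  'L_p[A, (f \* g)%R] <= 'L_(p * t)[A, f] * 'L_(p * u)[A, g].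
Proof.
move=> mA mf mg p0 t0 u0 tu; rewrite !LE.
apply: le_trans (Lnorm_hoelder mu (mr mA mf) (mr mA mg) p0 t0 u0 tu).
rewrite le_eqVlt; apply/orP; left; apply/eqP; congr (Lnorm mu _ (EFin \o _)).
by apply/funext => x; rewrite /= !patchE; case: ifP => //; rewrite mulr0.
Qed.

Lemma Lnorm_on_bounded A f g (M r : R) : measurable A ->
  measurable_fun A f -> measurable_fun A g -> (0 < r)%R -> (0 <= M)%R ->
  {ae mu, forall x, A x -> (`|g x| <= M)%R} ->
  'L_r[A, (f \* g)%R] <= M%:E * 'L_r[A, f].
Proof.
move=> mA mf mg r0 M0 gM; have -> : M%:E = `|M|%:E by rewrite ger0_norm.
rewrite -Lnorm_onZ//.
apply: le_Lnorm_on => //; [exact: measurable_funM|exact: measurable_funM|].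
apply: filterS gM => x gM Ax; right; split => //=.
by rewrite !normrM mulrC ler_pM// (le_trans (gM Ax))// ler_norm.
Qed.

Lemma Lnorm_on_avg A r : measurable A -> 0 < mu A -> mu A < +oo -> (0 < r)%R ->
  exists2 a : R, (0 < a)%R & forall f,
  ((mu A)^-1 * \int[mu]_(x in A) (`|f x| `^ r)%:E) `^ r^-1 = a%:E * 'L_r[A, f].
Proof.
move=> mA A0 Aoo r0.
have Afin : mu A \is a fin_num by rewrite ge0_fin_numE.
have A0' : (0 < fine (mu A))%R by rewrite fine_gt0// A0 Aoo.
exists ((fine (mu A))^-1 `^ r^-1)%R => [|f]; first by rewrite powR_gt0 ?invr_gt0.
rewrite -{1}(fineK Afin) inver gt_eqF// poweRM; last 2 first.
- by rewrite lee_fin invr_ge0 ltW.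
- by apply: integral_ge0 => x _; rewrite lee_fin powR_ge0.
rewrite poweR_EFin; congr (_ * _); rewrite unlock; congr (_ `^ _).
rewrite integral_mkcond; apply: eq_integral => x _; rewrite !patchE.
by case: ifP => //= _; rewrite normr0 powR0// gt_eqF.
Qed.

End Lnorm_on.

(** * Local and global estimates *)

Section euclidean_norm.
Context {R : realType} {n : nat}.
Implicit Types v x : 'rV[R]_n.+1.

Lemma ler_norm_enorm v : `|v| <= enorm v.
Proof.
apply: mx_norm_le => [|i]; first exact: sqrtr_ge0.
rewrite -sqrtr_sqr ler_wsqrtr// big_ord1 (bigD1 i)//= lerDl.
by rewrite sumr_ge0// => j _; exact: sqr_ge0.
Qed.

Lemma enorm_le_norm v : enorm v <= n.+1%:R * `|v|.
Proof.
rewrite -[leRHS]ger0_norm ?mulr_ge0// -sqrtr_sqr ler_wsqrtr// big_ord1.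
apply: (@le_trans _ _ (\sum_(j < n.+1) `|v| ^+ 2)).
  apply: ler_sum => j _; rewrite -[leLHS]real_normK ?num_real//.
  by rewrite ler_pXn2r ?nnegrE// ler_coord_norm.
rewrite sumr_const card_ord -[leLHS]mulr_natl exprMn; apply: ler_wpM2r.
  exact: sqr_ge0.
by rewrite -natrX ler_nat leq_pmulr.
Qed.

End euclidean_norm.

(** * Balls of the quasi-metric as Euclidean neighbourhoods *)

Section quasi_balls.
Context {R : realType} {n : nat}.
Local Notation E := 'rV[R]_n.+1.
Variables (Omega : set E) (rho : E -> E -> R).
Hypothesis Omega_open : open Omega.
Hypothesis rho_compatible : euclidean_compatible Omega rho.

Lemma qball_sub x r : qball Omega rho x r `<=` Omega.
Proof. by move=> y []. Qed.

Lemma qballS x r r' : r <= r' -> qball Omega rho x r `<=` qball Omega rho x r'.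
Proof. by move=> rr' y [Oy xy]; split => //; exact: lt_le_trans xy rr'. Qed.

Lemma qball_nbhs x r : Omega x -> 0 < r -> nbhs x (qball Omega rho x r).
Proof.
move=> Ox r0; have [/(_ _ r0)[d d0 dr] _] := rho_compatible Ox.
have : nbhs x (Omega `&` ball x (d / n.+1%:R)).
  apply: filterI; first exact: open_nbhs_nbhs.
  by apply: nbhsx_ballx; rewrite divr_gt0.
apply: filterS => y [Oy]; rewrite mx_norm_ball /ball_ /= => xy; apply: dr; split => //.
by rewrite (le_lt_trans (enorm_le_norm _))// mulrC -ltr_pdivlMr.
Qed.

Lemma qball_small x (U : set E) : Omega x -> nbhs x U ->
  exists2 r, 0 < r & qball Omega rho x r `<=` U.
Proof.
move=> Ox; rewrite -nbhs_ballE => -[d /= d0 dU].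
have [_ /(_ _ d0)[r r0 rd]] := rho_compatible Ox.
exists r => // y /rd[Oy xy]; apply: dU; rewrite mx_norm_ball /ball_ /=.
exact: le_lt_trans (ler_norm_enorm _) xy.
Qed.

Lemma lebesgue_outer_nbhs (x : E) (A : set E) : nbhs x A -> (0 < lebesgue_outer A)%E.
Proof.
rewrite nbhsE => -[U [oU Ux] UA]; apply: lt_le_trans (le_lebesgue_outer UA).
by apply: lebesgue_outer_open_gt0 => //; exists x.
Qed.

(** Positive finite measure is what turns averages over the ball into multiples of norms. A
    quasi-metric ball can be unbounded, so it is kept inside a Euclidean ball. *)
Lemma qball_measure x r : Omega x -> 0 < r -> qball Omega rho x r `<=` ball x 1 ->
  (0 < lebesgue_outer (qball Omega rho x r) < +oo)%E.
Proof.
move=> Ox r0 r1; rewrite (lebesgue_outer_nbhs (qball_nbhs Ox r0)) /=.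
apply: le_lt_trans (le_lebesgue_outer r1) _; apply: lebesgue_outer_bounded.
exists (`|x| + 1); split => // M M1 y; rewrite mx_norm_ball /ball_ /= => xy.
rewrite (le_trans _ (ltW M1))// -[y](subrK x) addrC (le_trans (ler_normD _ _))//.
by rewrite lerD2l distrC ltW.
Qed.

End quasi_balls.

Section gradient_bounds.
Context {R : realType} {n : nat}.
Local Notation E := 'rV[R]_n.+1.
Local Notation leb := (@lebesgue_outer R n).
Local Notation T := (caratheodory_type leb).
Local Notation mu := (@lebesgue_rV R n).
Local Open Scope ereal_scope.
Implicit Types (A B U : set E) (f g : E -> R) (r : R).

Lemma measurable_lipschitz (A : set T) f : lebesgue_measurable A -> lipschitz f ->
  measurable_fun A (f : T -> R).
Proof.
by move=> mA lf; apply: continuous_lebesgue_measurable => //; exact: lipschitz_continuous.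
Qed.

Lemma avg_norm_fin A r : lebesgue_measurable A -> 0 < leb A < +oo -> (0 < r)%R ->
  exists2 a : R, (0 < a)%R & forall f, avg_norm A r%:E f = a%:E * norm_on A r%:E f.
Proof.
move=> mA /andP[A0 Aoo] r0.
have [a a0 aE] := @Lnorm_on_avg _ T _ mu A r mA A0 Aoo r0.
by exists a => // f; exact: aE.
Qed.

Lemma le_norm_on (A B : set T) f g r : lebesgue_measurable A -> lebesgue_measurable B ->
  measurable_fun A (f : T -> R) -> measurable_fun B (g : T -> R) -> (0 < r)%R ->
  (forall x, A x -> f x = 0%R \/ B x /\ (`|f x| <= `|g x|)%R) ->
  norm_on A r%:E f <= norm_on B r%:E g.
Proof.
by move=> mA mB mf mg r0 fg; apply: le_Lnorm_on => //; apply: aeW => x; exact: fg.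
Qed.

Lemma norm_onS (A B : set T) f r : lebesgue_measurable A -> lebesgue_measurable B ->
  A `<=` B -> measurable_fun B (f : T -> R) -> (0 < r)%R ->
  norm_on A r%:E f <= norm_on B r%:E f.
Proof.
move=> mA mB AB mf r0; apply: le_norm_on => //.
  exact: (measurable_funS mB AB mf).
by move=> x Ax; right; split => //; exact: AB.
Qed.

Lemma hoelder_conjugate_fin (t : \bar R) : 1 < t ->
  exists2 u : R, (1 <= u)%R & hoelder_conjugate t = u%:E.
Proof.
case: t => [t||]//; last by move=> _; exists 1%R.
rewrite lte_fin => t1; exists (t / (t - 1))%R.
  by rewrite ler_pdivlMr ?subr_gt0// mul1r gerBl.
rewrite /hoelder_conjugate /= gt_eqF ?lte_fin ?(lt_trans ltr01)//.
by rewrite -EFinD inver subr_eq0 gt_eqF.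
Qed.

(** For finite t this is Hoelder with 1/p = 1/(pt') + 1/(pt); for t = +oo one has pt' = p, and the
    weight is essentially bounded. The maximum with 1 in K only secures positivity, as c is an
    arbitrary real. *)
Lemma norm_on_weight (A : set T) (p : R) (t : \bar R) g (c : R) :
  lebesgue_measurable A -> 0 < leb A < +oo -> (0 < p)%R -> 1 < t ->
  measurable_fun A (g : T -> R) -> avg_norm A (p%:E * t) g <= c%:E ->
  exists2 K : R, (0 < K)%R & forall f, measurable_fun A (f : T -> R) ->
  norm_on A p%:E (fun x => f x * g x)%R <=
    K%:E * norm_on A (p%:E * hoelder_conjugate t) f.
Proof.
move=> mA A0 p0; case: t => [t||]//.
  rewrite lte_fin => t1 mg; have t0 : (0 < t)%R by exact: lt_trans t1.
  have t10 : (0 < t - 1)%R by rewrite subr_gt0.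
  have pt0 : (0 < p * t)%R by rewrite mulr_gt0.
  have [a a0 aE] := avg_norm_fin mA A0 pt0.
  rewrite -EFinM aE => gc; exists (Num.max 1 (c / a))%R; first by rewrite lt_max ltr01.
  move=> f mf.
  have -> : hoelder_conjugate t%:E = (t / (t - 1))%:E.
    by rewrite /hoelder_conjugate /= gt_eqF ?lte_fin// -EFinD inver gt_eqF.
  have u0 : (0 < t / (t - 1))%R by rewrite divr_gt0.
  have ut : ((t / (t - 1))^-1 + t^-1 = 1)%R by field; rewrite !gt_eqF.
  apply: le_trans (@Lnorm_on_hoelder _ T _ mu A f g p _ _ mA mf mg p0 u0 t0 ut) _.
  rewrite muleC lee_wpmul2r ?Lnorm_ge0// EFin_max le_max; apply/orP; right.
  by rewrite [leRHS]EFinM [leRHS]muleC lee_pdivlMl.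
move=> _ mg; rewrite gt0_muley ?lte_fin// hoelder_conjugatey mule1 => gc.
have {}gc : ess_sup mu (abse \o ((EFin \o g) \_ A)) <= c%:E.
  (* The norm with exponent +oo is the essential supremum provided that the whole space has positive
     measure; the positive measure of A ensures this. *)
  move: gc; rewrite /avg_norm /norm_on unlock ifT//.
  by case/andP: A0 => A0 _; exact: lt_le_trans A0 (le_lebesgue_outer _).
exists (Num.max 1 c)%R; first by rewrite lt_max ltr01.
move=> f mf; apply: (@Lnorm_on_bounded _ T _ mu A f g) => //.
  by rewrite le_max ler01.
have /ess_supP := gc; apply: filterS => x + Ax.
rewrite /= patchE mem_set// lee_fin => /le_trans; apply.
by rewrite le_max lexx orbT.
Qed.

End gradient_bounds.

(** * Propagation of the bound through Omega and the Sobolev estimate on Theta *)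

Section global_sobolev.
Context {R : realType} {n : nat}.
Local Notation E := 'rV[R]_n.+1.
Local Notation leb := (@lebesgue_outer R n).
Local Notation T := (caratheodory_type leb).
Local Notation mu := (@lebesgue_rV R n).
Variables (Omega : set E) (rho : E -> E -> R) (Q : E -> 'M[R]_n.+1) (r1 : E -> R)
  (p : R) (t : \bar R) (Theta : set E).
Hypotheses (Omega_open : open Omega) (Omega_connected : connected Omega)
  (rho_measurable : forall x r, Omega x -> lebesgue_measurable (qball Omega rho x r))
  (rho_compatible : euclidean_compatible Omega rho)
  (p_gt1 : 1 < p) (t_gt1 : (1 < t)%E)
  (Q_psd : forall x, Omega x -> psd (Q x))
  (Q_measurable : forall i j, measurable_fun (Omega : set T) (fun x => Q x i j))
  (r1_gt0 : forall x, Omega x -> 0 < r1 x)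
  (Theta_open : open Theta) (Theta_inside : well_inside Theta Omega).
Implicit Types (A B U : set E) (f g : E -> R) (r : R).

Local Notation G f := (norm_on Theta p%:E (wgrad Q f)).

Let p_gt0 : 0 < p. Proof. exact: lt_trans p_gt1. Qed.

Let measurable_Theta : lebesgue_measurable Theta.
Proof. exact: open_lebesgue_measurable. Qed.

Let Theta_Omega : Theta `<=` Omega.
Proof. by apply: subset_trans (proj2 Theta_inside); exact: subset_closure. Qed.

Lemma measurable_wgrad_sub (A : set T) f : lebesgue_measurable A -> A `<=` Omega ->
  lipschitz f -> measurable_fun A (wgrad Q f : T -> R).
Proof.
move=> mA AO lf.
apply: (measurable_wgrad mA lf) => [x /AO|i j]; first exact: Q_psd.
exact: measurable_funS (open_lebesgue_measurable Omega_open) AO (Q_measurable i j).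
Qed.

Lemma Lip0_notin f x : Lip0 Theta f -> ~ Theta x -> ~ supp f x.
Proof. by move=> [_ [_ fT]]; apply: contra_not => fx; apply: fT; exact: subset_closure. Qed.

Lemma wgrad_norm_le (A : set T) f : lebesgue_measurable A -> A `<=` Omega ->
  Lip0 Theta f -> (norm_on A p%:E (wgrad Q f) <= G f)%E.
Proof.
move=> mA AO /[dup] f0 [lf _]; apply: le_norm_on => //.
- exact: measurable_wgrad_sub.
- exact: measurable_wgrad_sub.
move=> x Ax; have [Tx|nTx] := pselect (Theta x); [by right|left].
by apply: wgrad_notin_supp; exact: Lip0_notin f0 nTx.
Qed.

(** U may lie partly or wholly outside Theta, while the gradient norm on the right is always that
    over Theta. *)
Definition controlled r U := exists2 C : R, 0 < C &
  forall f, Lip0 Theta f -> (norm_on U r%:E f <= C%:E * G f)%E.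

Lemma controlledS r (A B : set T) : 0 < r -> lebesgue_measurable A ->
  lebesgue_measurable B -> A `<=` B -> controlled r B -> controlled r A.
Proof.
move=> r0 mA mB AB [C C0 BC]; exists C => // f f0; apply: le_trans (BC f f0).
by apply: norm_onS => //; apply: measurable_lipschitz => //; exact: (proj1 f0).
Qed.

Lemma controlledU r (A B : set T) : 1 <= r -> lebesgue_measurable A ->
  lebesgue_measurable B -> controlled r A -> controlled r B -> controlled r (A `|` B).
Proof.
move=> re1 mA mB [C C0 AC] [D D0 BD]; exists (C + D); first exact: addr_gt0.
move=> f f0; rewrite EFinD ge0_muleDl ?lee_fin ?(ltW C0) ?(ltW D0)//.
apply: le_trans (leeD (AC f f0) (BD f f0)).
by apply: Lnorm_onU => //; apply: measurable_lipschitz => //; exact: (proj1 f0).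
Qed.

Lemma controlled0 r U : 0 < r -> U `&` Theta = set0 -> controlled r U.
Proof.
move=> r0 UT; exists 1 => // f f0; rewrite mul1e /norm_on.
rewrite (_ : (EFin \o f) \_ U = cst 0%E) ?Lnorm0 ?Lnorm_ge0 ?eqe ?gt_eqF//.
apply/funext => x; rewrite patchE; case: ifPn => // /set_mem Ux /=; congr EFin.
apply: contrapT => /eqP fx; apply: (@Lip0_notin f x) => //.
  by move=> Tx; suff : set0 x by []; rewrite -UT.
exact: subset_closure.
Qed.

Variables (C1 beta : R).
Hypotheses (C1_gt0 : 0 < C1) (beta_ge1 : 1 <= beta)
  (poincare : forall (y : E) (r : R) (f : E -> R),
    Omega y -> 0 < beta * r < r1 y ->
    lipschitz f -> in_L (qball Omega rho y (beta * r)) p%:E (wgrad Q f) ->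
    let fB := fine (avg (qball Omega rho y r) (EFin \o f)) in
    (avg_norm (qball Omega rho y r) (p%:E * hoelder_conjugate t) (fun x => f x - fB)%R <=
       (C1 * r)%:E * avg_norm (qball Omega rho y (beta * r)) p%:E (wgrad Q f))%E).

Variable q : R.
Hypotheses (q_ge1 : 1 <= q) (qE : (p%:E * hoelder_conjugate t)%E = q%:E).

Let q_gt0 : 0 < q. Proof. exact: lt_le_trans q_ge1. Qed.

Lemma poincare_nbhs x : Omega x -> exists B : set E,
  [/\ lebesgue_measurable B, nbhs x B, (0 < leb B < +oo)%E &
   exists2 K : R, 0 < K & forall f, Lip0 Theta f ->
     exists c : R, (norm_on B q%:E (fun x => f x - c)%R <= K%:E * G f)%E].
Proof.
move=> Ox; have beta0 : 0 < beta by exact: lt_le_trans beta_ge1.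
have [r2 r20 r2B] := qball_small rho_compatible Ox (nbhsx_ballx x _ ltr01).
have rx := r1_gt0 Ox.
(* The larger ball, of radius beta r, must lie in the Euclidean unit ball and satisfy beta r < r1 x;
   halving [r1 x] makes the second inequality strict. *)
pose r := Num.min (r2 / beta) (r1 x / 2 / beta).
have r0 : 0 < r by rewrite lt_min !divr_gt0.
have br0 : 0 < beta * r by rewrite mulr_gt0.
have br2 : beta * r <= r2 by rewrite mulrC -ler_pdivlMr// ge_min lexx.
have br1 : beta * r < r1 x.
  rewrite mulrC -ltr_pdivlMr// gt_min; apply/orP; right.
  by rewrite ltr_pM2r ?invr_gt0//; lra.
have rbr : r <= beta * r by rewrite ler_peMl// ltW.
have B'1 : qball Omega rho x (beta * r) `<=` ball x 1.
  exact: subset_trans (qballS br2) r2B.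
have B1 : qball Omega rho x r `<=` ball x 1 by exact: subset_trans (qballS rbr) B'1.
have mB : lebesgue_measurable (qball Omega rho x r) by exact: rho_measurable.
have mB' : lebesgue_measurable (qball Omega rho x (beta * r)) by exact: rho_measurable.
have B0 := qball_measure Omega_open rho_compatible Ox r0 B1.
have B'0 := qball_measure Omega_open rho_compatible Ox br0 B'1.
exists (qball Omega rho x r); split => //; first exact: qball_nbhs.
have [a a0 aE] := avg_norm_fin mB B0 q_gt0.
have [b b0 bE] := avg_norm_fin mB' B'0 p_gt0.
exists (a^-1 * (C1 * r * b)); first by rewrite !mulr_gt0 ?invr_gt0.
move=> f /[dup] f0 [lf _].
(* If G f is infinite, any c will do. Otherwise G f bounds the gradient on the larger ball, which
   puts f within the scope of the Poincare inequality. *)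
have [Goo|Goo] := eqVneq (G f) +oo%E.
  by exists 0; rewrite Goo gt0_muley ?leey// lte_fin !mulr_gt0 ?invr_gt0.
have GB' := wgrad_norm_le mB' (@qball_sub _ _ Omega rho x _) f0.
exists (fine (avg (qball Omega rho x r) (EFin \o f))).
have := @poincare x r f Ox _ lf; rewrite br0 br1 => /(_ isT).
have -> : in_L (qball Omega rho x (beta * r)) p%:E (wgrad Q f) = True.
  apply/propT; split; last by rewrite (le_lt_trans GB')// ltey.
  by apply: measurable_wgrad_sub => //; exact: qball_sub.
move=> /(_ I); cbv zeta; rewrite qE aE bE => H.
rewrite EFinM -muleA lee_pdivlMl// (le_trans H)//.
rewrite [(C1 * r * b)%:E]EFinM -muleA; apply: lee_wpmul2l.
  by rewrite lee_fin mulr_ge0// ltW.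
by apply: lee_wpmul2l => //; rewrite lee_fin ltW.
Qed.

Lemma compact_closure_Theta : compact (closure Theta).
Proof.
apply: bounded_closed_compact; last exact: closed_closure.
have [M [Mr HM]] := proj1 Theta_inside; exists M; split => // N MN x.
have cN : closed [set y : E | `|y| <= N].
  rewrite [X in closed X](_ : _ = (fun y : E => `|y|) @^-1` [set z | z <= N])//.
  apply: preimage_closed; last exact: closed_le.
  by move=> y _; exact: norm_continuous.
have HN : Theta `<=` [set y : E | `|y| <= N] by exact: HM.
by move=> /(closureS HN); rewrite -((closure_id _).1 cN).
Qed.

(** Otherwise Omega = closure Theta is compact, and a point where the first coordinate is maximal
    contradicts openness: the upper corner of a small cube around it, which belongs to the half-open
    cube, lies in Omega too. *)
Lemma outside_closure : Omega !=set0 -> exists x, Omega x /\ ~ closure Theta x.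
Proof.
move=> O0; apply: contrapT => nex.
have OT : Omega = closure Theta.
  apply/seteqP; split; last exact: (proj2 Theta_inside).
  by move=> x Ox; apply: contrapT => Tx; apply: nex; exists x.
have cO : compact Omega by rewrite OT; exact: compact_closure_Theta.
have [c /set_mem Oc cmax] := compact_EVT_max O0 cO
  (continuous_subspaceT (@coord_continuous R 1 n.+1 ord0 ord0)).
have [d d0 dO] := open_cube Omega_open Oc.
have : Omega (c + const_mx d).
  apply: (dO c d) => //; first exact: cube_center.
  by move=> i; rewrite !mxE /=; apply/andP; split; lra.
by move=> /mem_set/cmax; rewrite !mxE; lra.
Qed.

Lemma norm_on_cst (A : set T) r : lebesgue_measurable A -> (0 < leb A < +oo)%E ->
  0 < r -> exists2 k : R, 0 < k &
  forall c : R, norm_on A r%:E (fun=> c) = (k * `|c|)%:E.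
Proof.
move=> mA /andP[A0 Aoo] r0.
exact: (@Lnorm_on_cst _ T _ mu A r mA A0 Aoo r0).
Qed.

Lemma controlled_nbhs (y : E) U B : open U -> U y -> controlled q U ->
  lebesgue_measurable B -> (B°) y -> (0 < leb B < +oo)%E ->
  (exists2 K : R, 0 < K & forall f, Lip0 Theta f ->
     exists c : R, (norm_on B q%:E (fun x => f x - c)%R <= K%:E * G f)%E) ->
  controlled q B.
Proof.
move=> oU Uy [C C0 UC] mB By B0 [K K0 BK].
(* V is open and nonempty, hence of positive measure, so the norm of a constant on V determines it.
   On V, c = (c - f) + f gives k |c| <= (K + C) G f; on B, f = (f - c) + c then gives the constant
   below. *)
pose V := U `&` B°.
have oV : open V by apply: openI => //; exact: open_interior.
have mV : lebesgue_measurable V by exact: open_lebesgue_measurable.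
have mU : lebesgue_measurable U by exact: open_lebesgue_measurable.
have VB : V `<=` B by move=> z [_]; exact: interior_subset.
have V0 : (0 < leb V < +oo)%E.
  apply/andP; split; first by apply: lebesgue_outer_open_gt0 => //; exists y.
  by case/andP: B0 => _; apply: le_lt_trans; exact: le_lebesgue_outer.
have [k k0 kE] := norm_on_cst mV V0 q_gt0.
have [b b0 bE] := norm_on_cst mB B0 q_gt0.
exists (K + b * ((K + C) / k)) => [|f f0].
  by rewrite addr_gt0// mulr_gt0// divr_gt0// addr_gt0.
have lf := proj1 f0.
have [c cK] := BK f f0.
have mf (A : set T) : lebesgue_measurable A -> measurable_fun A (f : T -> R).
  by move=> mA; exact: measurable_lipschitz.
have mfc (A : set T) : lebesgue_measurable A -> measurable_fun A (fun x : T => f x - c).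
  by move=> mA; apply: measurable_funB; [exact: mf|exact: measurable_cst].
have mcf : measurable_fun (V : set T) (fun x : T => c - f x).
  by apply: measurable_funB; [exact: measurable_cst|exact: mf].
have swap : (norm_on V q%:E (fun x => c - f x)%R <= norm_on V q%:E (fun x => f x - c)%R)%E.
  apply: (le_norm_on mV mV mcf (mfc _ mV) q_gt0).
  by move=> z Vz; right; split => //; rewrite distrC.
have cle : (`|c|%:E <= ((K + C) / k)%:E * G f)%E.
  have : (norm_on V q%:E (fun=> c) <=
      norm_on V q%:E (fun x => f x - c)%R + norm_on V q%:E f)%E.
    apply: le_trans (leeD swap (lexx _)).
    have := @Lnorm_onD _ T _ mu V (fun x => c - f x) f q mV mcf (mf _ mV) q_ge1.
    rewrite (_ : (fun x => c - f x) \+ f = fun=> c)//.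
    by apply/funext => z /=; rewrite subrK.
  rewrite kE => H.
  rewrite mulrC EFinM -muleA lee_pdivlMl// -EFinM (le_trans H)// EFinD.
  rewrite ge0_muleDl ?lee_fin ?(ltW K0) ?(ltW C0)//; apply: leeD.
    by apply: le_trans cK; exact: (norm_onS mV mB VB (mfc _ mB) q_gt0).
  apply: le_trans (UC f f0).
  by apply: (norm_onS mV mU _ (mf _ mU) q_gt0) => z [].
have : (norm_on B q%:E f <=
    norm_on B q%:E (fun x => f x - c)%R + norm_on B q%:E (fun=> c))%E.
  have := @Lnorm_onD _ T _ mu B (fun x => f x - c) (fun=> c) q mB (mfc _ mB)
    (measurable_cst _) q_ge1.
  rewrite (_ : (fun x => f x - c) \+ (fun=> c) = f)//.
  by apply/funext => z /=; rewrite subrK.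
move=> /le_trans; apply; rewrite EFinD ge0_muleDl ?lee_fin ?(ltW K0)//; last first.
  by rewrite !mulr_ge0 ?invr_ge0 ?addr_ge0 ?ltW.
apply: leeD => //; rewrite bE !EFinM -muleA; apply: lee_wpmul2l => //.
by rewrite lee_fin ltW.
Qed.

(** The points with a controlled neighbourhood form a nonempty, relatively open and closed subset of
    Omega. For closedness, the Poincare ball of a limit point y is chosen by y alone, and its
    interior contains a point z that already has a controlled neighbourhood. *)
Lemma controlled_Omega x : Omega x -> exists U, [/\ open U, U x & controlled q U].
Proof.
move=> Ox.
pose S := [set x | exists U, [/\ open U, U x & controlled q U]].
suff OS : Omega = Omega `&` S by move: Ox; rewrite OS => -[].
apply/esym; apply: Omega_connected.
- have [y [Oy Ty]] := outside_closure (ex_intro _ x Ox); exists y; split => //.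
  exists (~` closure Theta); split => //; first exact/closed_openC/closed_closure.
  apply: controlled0 => //; apply/seteqP; split => // z [nTz Tz]; apply: nTz.
  exact: subset_closure.
- exists S => //; rewrite openE => y [U [oU Uy cU]]; rewrite /interior nbhsE.
  by exists U => // z Uz; exists U.
exists (closure (Omega `&` S)); first exact: closed_closure.
apply/seteqP; split => y [Oy Sy]; split => //; first exact: subset_closure.
have [B [mB yB B0 BK]] := poincare_nbhs Oy.
have [z [[Oz [U [oU Uz cU]]] Bz]] := Sy _ (nbhs_interior yB).
have cB := controlled_nbhs oU Uz cU mB Bz B0 BK.
exists B°; split; [exact: open_interior|exact: nbhs_singleton (nbhs_interior yB)|].
apply: controlledS cB => //; last exact: interior_subset.
exact/open_lebesgue_measurable/open_interior.
Qed.

Lemma Lip0_bounded U f : Lip0 U f -> exists M, forall x, `|f x| <= M.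
Proof.
move=> [/lipschitz_bound[L L0 fL] [[M [_ HM]] _]].
have /HM fM : M < `|M| + 1 by rewrite (le_lt_trans (ler_norm _))// ltrDl.
exists (`|f 0| + L * (`|M| + 1)) => x; have [->|fx] := eqVneq (f x) 0.
  by rewrite normr0 addr_ge0// mulr_ge0 ?ltW// addr_ge0.
rewrite -[f x](subrK (f 0)) addrC (le_trans (ler_normD _ _))// lerD2l.
rewrite (le_trans (fL _ _))// subr0 ler_wpM2l ?(ltW L0)//.
by apply: fM; exact: subset_closure.
Qed.

(** Makes 1 an admissible weight in [norm_on_weight], which then bounds the L^p norm by the L^(pt')
    norm. *)
Lemma avg_norm_cst1 (A : set T) : lebesgue_measurable A -> (0 < leb A < +oo)%E ->
  exists c : R, (avg_norm A (p%:E * t) (fun=> 1%R) <= c%:E)%E.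
Proof.
move=> mA A0; case: t t_gt1 => [v||]// v1.
  have pv0 : 0 < p * v by rewrite mulr_gt0// (lt_trans ltr01)// -lte_fin.
  have [a a0 aE] := avg_norm_fin mA A0 pv0.
  have [k k0 kE] := norm_on_cst mA A0 pv0.
  by exists (a * (k * `|1|)); rewrite -EFinM aE kE -EFinM.
exists 1; rewrite gt0_muley ?lte_fin// /avg_norm /norm_on unlock ifT; last first.
  by case/andP: A0 => A0 _; exact: lt_le_trans A0 (le_lebesgue_outer _).
apply/ess_supP; apply: aeW => x /=; rewrite patchE.
by case: ifP => _ /=; rewrite ?normr1 ?normr0 lee_fin.
Qed.

Lemma ae_not_nondiff f : lipschitz f -> {ae mu, forall x, ~ nondiff f x}.
Proof.
move=> lf; exists (nondiff f); split.
- by apply: lebesgue_null_measurable; exact: nondiff_null.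
- exact: nondiff_null.
- by move=> x /contrapT.
Qed.

Variable sigma : R.
Hypotheses (sigma_ge1 : 1 <= sigma)
  (cutoff : cutoff_condition Omega rho Q r1 (p%:E * t)%E)
  (sobolev : local_sobolev Omega rho Q r1 p sigma).

Lemma controlled_sobolev x : Omega x ->
  exists W, [/\ open W, W x & controlled (p * sigma) W].
Proof.
move=> Ox; have [U [oU Ux [C C_gt0 UC]]] := controlled_Omega Ox.
have [C3 [N [alpha [C3_gt0 N_gt0 /andP[alpha0 alpha1] cut]]]] := cutoff.
have [C0 C0_gt0 sob] := sobolev.
have [r2 r20 r2U] : exists2 r, 0 < r & qball Omega rho x r `<=` U `&` ball x 1.
  apply: qball_small => //; apply: filterI; first exact: open_nbhs_nbhs.
  exact: nbhsx_ballx.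
pose r := Num.min r2 (r1 x / 2); have rx := r1_gt0 Ox.
have r_gt0 : 0 < r by rewrite lt_min r20 divr_gt0.
have rr1 : 0 < r < r1 x by rewrite r_gt0 gt_min; apply/orP; right; lra.
pose B := qball Omega rho x r.
have BU : B `<=` U `&` ball x 1.
  by apply: subset_trans r2U; apply: qballS; rewrite ge_min lexx.
have BO : B `<=` Omega by exact: qball_sub.
have mB : lebesgue_measurable B by exact: rho_measurable.
have mU : lebesgue_measurable U by exact: open_lebesgue_measurable.
have B0 : (0 < leb B < +oo)%E.
  by apply: qball_measure => //; apply: subset_trans BU _ => z [].
have [psi [_ /(_ 1%N isT)[psi0 psi01 psi1 _ psiw]]] := cut x r Ox rr1.
move: (psi 1%N) psi0 psi01 psi1 psiw => {}psi psi0 psi01 psi1 psiw.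
have lpsi := proj1 psi0.
have mw f : lipschitz f -> measurable_fun (B : set T) (wgrad Q f).
  by move=> lf; exact: measurable_wgrad_sub.
(* K1 belongs to the weight |sqrt(Q) grad psi|, for the term f grad psi of the product rule; K2
   belongs to the weight 1, for the zero-order term of the Sobolev inequality. *)
have [K1 K1_gt0 K1E] := norm_on_weight mB B0 p_gt0 t_gt1 (mw _ lpsi) psiw.
have [c1 c1E] := avg_norm_cst1 mB B0.
have [K2 K2_gt0 K2E] := norm_on_weight mB B0 p_gt0 t_gt1 (measurable_cst _) c1E.
rewrite qE in K1E K2E.
have ps_gt0 : 0 < p * sigma by rewrite mulr_gt0// (lt_le_trans ltr01).
have [a a_gt0 aE] := avg_norm_fin mB B0 ps_gt0.
have [b b_gt0 bE] := avg_norm_fin mB B0 p_gt0.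
(* On this set psi = 1, so f = psi f there. The interior is taken because a quasi-metric ball need
   not be open. *)
exists (qball Omega rho x (alpha * r))°; split; first exact: open_interior.
  have ar0 : 0 < alpha * r by rewrite mulr_gt0.
  exact: nbhs_singleton (nbhs_interior (qball_nbhs Omega_open rho_compatible Ox ar0)).
(* The factors a and b convert averages over B into norms. The gradient of psi f costs 1 + K1 C and
   psi f itself K2 C, where C bounds f on U. *)
exists (a^-1 * ((C0 * r * b) * (1 + K1 * C) + (C0 * b) * (K2 * C))).
  by rewrite !(mulr_gt0, addr_gt0) ?invr_gt0.
move=> f /[dup] f0 [lf _].
have mf (A : set T) : lebesgue_measurable A -> measurable_fun A (f : T -> R).
  by move=> mA; exact: measurable_lipschitz.
have lpf : lipschitz (psi * f).
  have [M fM] := Lip0_bounded f0.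
  apply: (@lipschitz_mul _ _ psi f 1 M) => // z.
  by have /andP[? ?] := psi01 z; rewrite ger0_norm.
have pf0 : Lip0 B (psi * f).
  split => //; have [_ [psib psic]] := psi0.
  have sub : supp (psi * f) `<=` supp psi.
    by apply: closureS => z /=; apply: contra_neq => psz; rewrite !fctE psz mul0r.
  split; first by case: psib => M [Mr HM]; exists M; split => // M' /HM MM z /sub/MM.
  exact: subset_trans (closureS sub) psic.
have fq : (norm_on B q%:E f <= C%:E * G f)%E.
  apply: le_trans (UC f f0); apply: (norm_onS mB mU _ (mf _ mU) q_gt0).
  by move=> z /BU[].
have nf : (norm_on B q%:E (fun x => `|f x|)%R <= norm_on B q%:E f)%E.
  apply: (le_norm_on mB mB _ (mf _ mB) q_gt0).
    by apply: measurableT_comp => //; exact: mf.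
  by move=> z Bz; right; rewrite normr_id.
have mfw : measurable_fun (B : set T) (fun x : T => `|f x| * wgrad Q psi x).
  apply: measurable_funM; last exact: mw.
  by apply: measurableT_comp => //; exact: mf.
have msum : measurable_fun (B : set T) (fun x : T => wgrad Q f x + `|f x| * wgrad Q psi x).
  by apply: measurable_funD; [exact: mw|exact: mfw].
have Nw : (norm_on B p%:E (wgrad Q (psi * f)%R) <= (1 + K1 * C)%:E * G f)%E.
  apply: (@le_trans _ _
      (norm_on B p%:E (fun x => wgrad Q f x + `|f x| * wgrad Q psi x)%R)).
    apply: (@le_Lnorm_on _ T _ mu B B (wgrad Q (psi * f))) => //; first exact: mw.
    have aeF := ae_filter_ringOfSetsType mu.
    apply: filterS2 (ae_not_nondiff lf) (ae_not_nondiff lpsi) => z fz pz Bz.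
    right; split => //; rewrite ger0_norm ?wgrad_ge0// (le_trans _ (ler_norm _))//.
    apply: le_trans (wgradM (Q_psd (BO _ Bz)) pz fz) _.
    rewrite lerD2r ler_piMl ?wgrad_ge0//.
    by have /andP[? ?] := psi01 z; rewrite ger0_norm.
  apply: le_trans (@Lnorm_onD _ T _ mu B (wgrad Q f) _ p mB (mw _ lf) mfw (ltW p_gt1)) _.
  rewrite EFinD ge0_muleDl ?lee_fin ?mulr_ge0 ?(ltW K1_gt0) ?(ltW C_gt0)//.
  apply: leeD; first by rewrite mul1e; exact: wgrad_norm_le.
  have mnf : measurable_fun (B : set T) (fun x : T => `|f x|).
    by apply: measurableT_comp => //; exact: mf.
  apply: le_trans (K1E _ mnf) _; rewrite EFinM -muleA; apply: lee_wpmul2l.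
    by rewrite lee_fin ltW.
  exact: le_trans nf fq.
have Np : (norm_on B p%:E (psi * f)%R <= (K2 * C)%:E * G f)%E.
  apply: (@le_trans _ _ (norm_on B p%:E (fun x => f x * 1)%R)).
    apply: (le_norm_on mB mB (measurable_lipschitz mB lpf) _ p_gt0).
      by apply: measurable_funM; [exact: mf|exact: measurable_cst].
    move=> z Bz; right; split => //; rewrite mulr1 !fctE normrM ler_piMl//.
    by have /andP[? ?] := psi01 z; rewrite ger0_norm.
  apply: le_trans (K2E _ (mf _ mB)) _; rewrite EFinM -muleA; apply: lee_wpmul2l => //.
  by rewrite lee_fin ltW.
have := sob x r (psi * f) Ox rr1 pf0; rewrite aE !bE => H.
rewrite [X in (_ <= X * _)%E]EFinM -muleA lee_pdivlMl//.
apply: (@le_trans _ _ (a%:E * norm_on B (p * sigma)%:E (psi * f)%R)%E).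
  apply: lee_wpmul2l; first by rewrite lee_fin ltW.
  have mW : lebesgue_measurable (qball Omega rho x (alpha * r))°.
    exact/open_lebesgue_measurable/open_interior.
  apply: (le_norm_on mW mB (mf _ mW) (measurable_lipschitz mB lpf) ps_gt0).
  move=> z /interior_subset/psi1[Bz pz]; right; split => //.
  by rewrite !fctE pz mul1r.
apply: (le_trans H); rewrite EFinD ge0_muleDl; last 2 first.
- by rewrite lee_fin !(mulr_ge0, addr_ge0)// ltW.
- by rewrite lee_fin !(mulr_ge0, addr_ge0)// ltW.
apply: leeD.
  rewrite [(C0 * r * b * _)%:E]EFinM [(C0 * r * b)%:E]EFinM -!muleA.
  apply: lee_wpmul2l; first by rewrite lee_fin mulr_ge0// ltW.
  by apply: lee_wpmul2l => //; rewrite lee_fin ltW.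
rewrite [(C0 * b * _)%:E]EFinM [(C0 * b)%:E]EFinM -!muleA.
apply: lee_wpmul2l; first by rewrite lee_fin ltW.
by apply: lee_wpmul2l => //; rewrite lee_fin ltW.
Qed.

Lemma controlled_Theta : controlled (p * sigma) Theta.
Proof.
have ps1 : 1 <= p * sigma by rewrite mulr_ege1// ltW.
have ps0 : 0 < p * sigma by exact: lt_le_trans ps1.
have /choice[W WE] : forall x, exists W, Omega x ->
    [/\ open W, W x & controlled (p * sigma) W].
  move=> x; have [/controlled_sobolev[W HW]|nOx] := pselect (Omega x).
    by exists W.
  (* A dummy value: points outside Omega never enter the cover. *)
  by exists set0 => /nOx.
have := compact_closure_Theta; rewrite compact_cover.
move=> /(_ _ Omega W)[|y Ty|D DO Dcov]; first by move=> x /WE[].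
  have Oy := proj2 Theta_inside _ Ty.
  by exists y => //; have [] := WE _ Oy.
move: Dcov; set V := cover _ W => Dcov.
have [oV cV] : open V /\ controlled (p * sigma) V.
  (* Openness is carried through the induction on the finite union because [controlledU] needs
     measurable sets. *)
  rewrite /V /cover bigcup_fset big_seq; elim/big_ind: _ => [|A B [oA cA] [oB cB]|i iD].
  - by split; [exact: open0|apply: controlled0; rewrite ?set0I].
  - split; first exact: openU.
    by apply: controlledU => //; exact: open_lebesgue_measurable.
  - by have /WE[] : Omega i by apply/set_mem; exact: DO.
apply: controlledS cV => //; first exact: open_lebesgue_measurable.
by move=> z Tz; apply: Dcov; exact: subset_closure.
Qed.

End global_sobolev.

Theorem theorem2p7 (R : realType) (n : nat)
    (Omega : set 'rV[R]_n.+1) (rho : 'rV[R]_n.+1 -> 'rV[R]_n.+1 -> R)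
    (Q : 'rV[R]_n.+1 -> 'M[R]_n.+1) (r1 : 'rV[R]_n.+1 -> R)
    (p sigma : R) (t s : \bar R)
    (Omega_open : open Omega) (Omega_connected : connected Omega)
    (rho_quasi_metric : quasi_metric Omega rho)
    (rho_measurable : forall x r, Omega x ->
       lebesgue_measurable (qball Omega rho x r))
    (rho_compatible : euclidean_compatible Omega rho)
    (p_gt1 : 1 < p) (t_gt1 : (1 < t)%E)
    (Q_psd : forall x, Omega x -> psd (Q x))
    (Q_measurable : forall i j,
       measurable_fun (Omega : set (caratheodory_type lebesgue_outer))
         (fun x => Q x i j))
    (Q_Lloc : in_Lloc Omega (p%:E * t / 2%:E)%E (op_norm \o Q))
    (r1_gt0 : forall x, Omega x -> 0 < r1 x)
    (r1_continuous : {within Omega, continuous r1})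
    (sigma_ge1 : 1 <= sigma)
    (s_pt : s = (p%:E * t)%E)
    (s_gt : (p%:E * hoelder_conjugate sigma%:E < s)%E)
    (cutoff : cutoff_condition Omega rho Q r1 s)
    (poincare : local_poincare Omega rho Q r1 p (hoelder_conjugate t))
    (sobolev : local_sobolev Omega rho Q r1 p sigma) :
  forall Theta : set 'rV[R]_n.+1, open Theta -> well_inside Theta Omega ->
  exists2 C : R, 0 < C &
  forall f : 'rV[R]_n.+1 -> R, Lip0 Theta f ->
    (norm_on Theta (p * sigma)%:E f <=
       C%:E * norm_on Theta p%:E (wgrad Q f))%E.
Proof.
move=> Theta Theta_open Theta_inside.
have [C1 [beta [C1_gt0 beta_ge1 poinc]]] := poincare.
have [u u1 uE] := hoelder_conjugate_fin t_gt1.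
rewrite s_pt in cutoff.
(* The exponent pt' is the real number p u, since t > 1 makes t' finite; u >= 1 gives the exponent
   at least 1 that Minkowski's inequality requires. *)
apply: (controlled_Theta Omega_open Omega_connected rho_measurable rho_compatible
  p_gt1 t_gt1 Q_psd Q_measurable r1_gt0 Theta_open Theta_inside C1_gt0 beta_ge1
  poinc (q := p * u)) => //.
- by rewrite mulr_ege1// ltW.
- by rewrite uE EFinM.
Qed.
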